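(* Let $F(w)=\frac1n\sum_{i=1}^n F_i(w)$, where each $F_i:\mathbb{R}^d\to\mathbb{R}$ is smooth and convex, and let $w^*$ be the minimizer of $F$. Suppose that Assumptions A.1--A.4 listed in the context hold, with constants $\mu,L,M,\gamma,\sigma$ and $\kappa=L/\mu$. Let $\{w_k\}$ be the iterates generated by the Subsampled Newton-CG method (SSN-CG) described in the context, with $\alpha_k=1$ and $$|T_k| = T \ge \frac{64\sigma^2}{\mu^2},$$ and suppose that the number of CG steps performed at iteration $k$ is the smallest integer $r_k$ such that $$\left(\frac{\lambda^{T_k}_{d-r_k+1}-\lambda^{T_k}_1}{\lambda^{T_k}_{d-r_k+1}+\lambda^{T_k}_1}\right)\le \frac{1}{8\kappa^{3/2}},$$ where $0<\lambda_1^{T_k}\le\lambda_2^{T_k}\le\cdots\le\lambda_d^{T_k}$ are the eigenvalues of the subsampled Hessian $\nabla^2F_{T_k}(w_k)$. Then, if $$\|w_0-w^*\|\le\min\left\{\frac{\mu}{2M},\frac{\mu}{2\gamma M}\right\},$$ we have $$\mathbb{E}\left[\|w_{k+1}-w^*\|\right]\le \tfrac12\,\mathbb{E}\left[\|w_k-w^*\|\right],\qquad k=0,1,\ldots$$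
   Context: **SSN-CG method.** Start from $w_0\in\mathbb{R}^d$. At iteration $k$, an index set $T_k\subset\{1,\dots,n\}$ is chosen, either uniformly at random (with or without replacement) or in a non-uniform manner, and the subsampled Hessian is defined as $$\nabla^2F_{T_k}(w_k)=\frac{1}{|T_k|}\sum_{i\in T_k}\nabla^2F_i(w_k).$$ The size $|T_k|=T$ is constant throughout the run, but the sample $T_k$ itself varies at every iteration. The search direction $p_k$ is the inexact solution obtained by running $r_k\le d$ iterations of the conjugate gradient (CG) method on the linear system $$\nabla^2F_{T_k}(w_k)\,p=-\nabla F(w_k),$$ where the gradient $\nabla F(w_k)$ is exact. The new iterate is $w_{k+1}=w_k+\alpha_kp_k$, where $\alpha_k$ is the steplength. **Assumptions.** A.1 (Bounded eigenvalues of Hessians) Each function $F_i$ is twice continuously differentiable and each component Hessian is positive definite with eigenvalues lying in a positive interval: there exist positive constants $\mu,L$ such that $\mu I\preceq\nabla^2F_i(w)\preceq LI$ for all $w\in\mathbb{R}^d$. Define $\kappa=L/\mu$. A.2 (Lipschitz continuity of Hessian) There is a constant $M>0$ such that $\|\nabla^2F(w)-\nabla^2F(z)\|\le M\|w-z\|$ for all $w,z\in\mathbb{R}^d$. A.3 (Bounded variance of Hessian components) There is a constant $\sigma$ such that, for all component Hessians, $\|\mathbb{E}[(\nabla^2F_i(w)-\nabla^2F(w))^2]\|\le\sigma^2$ for all $w\in\mathbb{R}^d$ (expectation over the random choice of the component index $i$). A.4 (Bounded moments of iterates) There is a constant $\gamma>0$ such that any iterate $w_k$ generated by the SSN-CG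 method satisfies $\mathbb{E}[\|w_k-w^*\|^2]\le\gamma\,(\mathbb{E}[\|w_k-w^*\|])^2$. **Notation.** $\|\cdot\|$ is the Euclidean norm for vectors and the induced (spectral) norm for matrices. In A.4 and in the conclusion, $\mathbb{E}$ denotes total expectation.
   Formalization: Sampling ''in a non-uniform manner'' is restricted to independent draws from an index law under which the mean component Hessian equals the full Hessian, with the expectation in A.3 taken under that law; for arbitrary non-uniform sampling the claim is false. *)

(* Defs.v *)
From HB Require Import structures.
From mathcomp Require Import all_boot all_order all_algebra.
From mathcomp Require Import all_classical all_reals all_analysis.

Set Implicit Arguments.
Unset Strict Implicit.
Unset Printing Implicit Defensive.

Import Order.TTheory GRing.Theory Num.Theory.
Import numFieldNormedType.Exports.

Local Open Scope classical_set_scope.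
Local Open Scope ring_scope.

(** ** Euclidean geometry

    The library norm `|x| on matrices is the maximum norm, hence the
    Euclidean and spectral norms below.  Topology and derivatives on
    'cV[R]_d are those of the library; they do not depend on the norm. *)

Definition enorm (R : realType) (d : nat) (x : 'cV[R]_d) : R :=
  Num.sqrt (\sum_(i < d) x i 0 ^+ 2).

Definition spectral_norm (R : realType) (d : nat) (A : 'M[R]_d) : R :=
  sup [set enorm (A *m x) | x in [set x : 'cV[R]_d | enorm x <= 1]].

Definition psd (R : realType) (d : nat) (A : 'M[R]_d) : Prop :=
  A^T = A /\ forall v : 'cV[R]_d, 0 <= (v^T *m A *m v) 0 0.

Definition loewner_le (R : realType) (d : nat) (A B : 'M[R]_d) : Prop :=
  psd (B - A).

(** The eigenvalues of [A], with multiplicity, in nondecreasing order. *)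
Definition ordered_spectrum (R : realType) (d : nat) (A : 'M[R]_d)
    (lambda : seq R) : Prop :=
  sorted <=%R lambda /\
  char_poly A = \prod_(l <- lambda) ('X - l%:P).

(** ** Differential calculus *)

Definition partial (R : realType) (d : nat) (i : 'I_d) (f : 'cV[R]_d -> R)
    (w : 'cV[R]_d) : R :=
  'D_(delta_mx i 0) f w.

Definition gradient (R : realType) (d : nat) (f : 'cV[R]_d -> R)
    (w : 'cV[R]_d) : 'cV[R]_d :=
  \col_i partial i f w.

Definition hessian (R : realType) (d : nat) (f : 'cV[R]_d -> R)
    (w : 'cV[R]_d) : 'M[R]_d :=
  \matrix_(i, j) partial i (partial j f) w.

Definition twice_continuously_differentiable (R : realType) (d : nat)
    (f : 'cV[R]_d -> R) : Prop :=
  [/\ forall w, differentiable f w,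
      forall i w, differentiable (partial i f) w
    & forall i j, continuous (partial i (partial j f))].

(** ** Finite sums and subsampling *)

Definition average (R : realType) (d n : nat) (F : 'I_n -> 'cV[R]_d -> R)
    (w : 'cV[R]_d) : R :=
  n%:R^-1 * \sum_(i < n) F i w.

(** A sample of size [T] is the tuple of the indices drawn, so that samples
    with repeated indices are covered. *)
Definition subsampled_hessian (R : realType) (d n T : nat)
    (F : 'I_n -> 'cV[R]_d -> R) (s : T.-tuple 'I_n) (w : 'cV[R]_d) : 'M[R]_d :=
  T%:R^-1 *: \sum_(i <- s) hessian (F i) w.

(** [sampling_scheme H p q]: a single index is distributed according to [p]
    and the whole sample according to [q].  [H i] is the [i]-th component
    Hessian at the current iterate.  Since the subsampled Hessian is an
    unweighted average, draws from a non-uniform [p] estimate the mean of [H]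
    only under the last condition of [Nonuniform].  Without replacement, the
    injective [T]-tuples, of which there are [n ^_ T], are equally likely. *)
Variant sampling_scheme (R : realType) (d n T : nat) (H : 'I_n -> 'M[R]_d)
    (p : 'I_n -> R) (q : T.-tuple 'I_n -> R) : Prop :=
  | UniformWithReplacement of
      (forall i, p i = n%:R^-1) &
      (forall s, q s = \prod_(i <- s) p i)
  | UniformWithoutReplacement of
      (forall i, p i = n%:R^-1) &
      (forall s, q s = if uniq s then (n ^_ T)%:R^-1 else 0)
  | Nonuniform of
      (forall i, 0 <= p i) &
      \sum_(i < n) p i = 1 &
      (forall s, q s = \prod_(i <- s) p i) &
      \sum_(i < n) p i *: H i = n%:R^-1 *: \sum_(i < n) H i.

(** ** The conjugate gradient method *)

(** State: approximate solution, residual [b - A x], conjugate direction.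
    As [x / 0 = 0], the state no longer changes once the residual is 0. *)
Definition cg_step (R : realType) (d : nat) (A : 'M[R]_d)
    (st : 'cV[R]_d * 'cV[R]_d * 'cV[R]_d) : 'cV[R]_d * 'cV[R]_d * 'cV[R]_d :=
  let: (x, res, dir) := st in
  let a := (res^T *m res) 0 0 / (dir^T *m A *m dir) 0 0 in
  let res' := res - a *: (A *m dir) in
  let b := (res'^T *m res') 0 0 / (res^T *m res) 0 0 in
  (x + a *: dir, res', res' + b *: dir).

(** Result of [r] CG iterations on [A x = b] started at [x = 0]. *)
Definition cg (R : realType) (d : nat) (A : 'M[R]_d) (b : 'cV[R]_d) (r : nat) :
    'cV[R]_d :=
  (iter r (cg_step A) (0, b, b)).1.1.

(** [lambda_j] (numbered from 1) is [lambda`_(j - 1)], so that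
    [lambda_(d - r + 1)] is [lambda`_(d - r)]. *)
Definition cg_ratio (R : realType) (d : nat) (lambda : seq R) (r : nat) : R :=
  (lambda`_(d - r) - lambda`_0) / (lambda`_(d - r) + lambda`_0).

(** [r] is the least index in [1, d] whose CG ratio is at most [tol]. *)
Definition least_cg_steps (R : realType) (d : nat) (A : 'M[R]_d) (tol : R)
    (r : nat) : Prop :=
  exists lambda : seq R,
    [/\ ordered_spectrum A lambda,
        (1 <= r <= d)%N,
        cg_ratio d lambda r <= tol
      & forall r', (1 <= r' <= d)%N -> cg_ratio d lambda r' <= tol ->
          (r <= r')%N].

(** ** The subsampled Newton-CG method *)

(** Along each outcome [o], [S k o] is the sample, [r k o] the number of CG
    iterations and [w k o] the iterate. *)
Record SSN_CG (R : realType) (d n T : nat) (Omega : Type)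
    (F : 'I_n -> 'cV[R]_d -> R) (alpha : nat -> R) (w0 : 'cV[R]_d)
    (S : nat -> Omega -> T.-tuple 'I_n) (r : nat -> Omega -> nat)
    (w : nat -> Omega -> 'cV[R]_d) : Prop := {
  SSN_CG_init : forall o, w 0%N o = w0 ;
  SSN_CG_steps : forall k o, (r k o <= d)%N ;
  SSN_CG_next : forall k o,
    w k.+1 o = w k o + alpha k *:
      cg (subsampled_hessian F (S k o) (w k o))
         (- gradient (average F) (w k o)) (r k o) }.

(** Given the samples of the previous iterations and the current iterate [v],
    the [k]-th sample has distribution [q k v]; for uniform sampling this says
    that the samples are independent.  All variables are discrete, hence the
    elementary form of conditioning. *)
Definition sampled_from (R : realType) (d n T : nat) (disp : measure_display)
    (Omega : measurableType disp) (P : probability Omega R)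
    (q : nat -> 'cV[R]_d -> T.-tuple 'I_n -> R)
    (S : nat -> Omega -> T.-tuple 'I_n) (w : nat -> Omega -> 'cV[R]_d) : Prop :=
  (forall k s, measurable [set o | S k o = s]) /\
  forall k (h : nat -> T.-tuple 'I_n) (v : 'cV[R]_d) (s : T.-tuple 'I_n),
    let past := [set o | (forall j, (j < k)%N -> S j o = h j) /\ w k o = v] in
    P (past `&` [set o | S k o = s]) = ((q k v s)%:E * P past)%E.

(* Main.v *)
(** For the exact Newton step with Hessian [A = A_s] the error is
    [A^-1 ((A - H) e + (H e - g))] with [e = w_k - w*], [H] the full Hessian and
    [g] the gradient at [w_k].  The Taylor remainder [H e - g] is at most
    [M/2 |e|^2], and, conditionally on the past, [(A - H) e] has mean square at
    most [sigma^2 / T |e|^2 <= (mu/8)^2 |e|^2], also without replacement because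
    the draws are then negatively correlated.  The CG error is at most [|e|/8]:
    the CG iterate minimizes the [A]-norm of the error over a Krylov space, and
    testing this with a polynomial that vanishes at the [r - 1] largest
    eigenvalues gives the contraction factor [cg_ratio].  Hence
    [E |e_(k+1)| <= M/(2 mu) E |e_k|^2 + 1/4 E |e_k|], and A.4 with
    [E |e_k| <= mu/(2 gamma M)] bounds the first term by [1/4 E |e_k|].
    Since the samples take finitely many values, all expectations are finite
    sums over sample histories. *)

Require Import Defs.
From HB Require Import structures.
From mathcomp Require Import all_boot all_order all_algebra.
From mathcomp Require Import all_classical all_reals all_analysis.
From mathcomp Require Import measurable_realfun complex spectral ring lra zify.
Set Implicit Arguments.
Unset Strict Implicit.
Unset Printing Implicit Defensive.
Import Order.TTheory GRing.Theory Num.Theory.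
Import numFieldNormedType.Exports.
Local Open Scope classical_set_scope.
Local Open Scope ring_scope.

(** * Euclidean geometry *)

Section Euclid.
Context {R : realType} {d : nat}.
Implicit Types (u v x y : 'cV[R]_d) (A B : 'M[R]_d).

Definition dot u v : R := (u^T *m v) 0 0.

Lemma dotE u v : dot u v = \sum_i u i 0 * v i 0.
Proof. by rewrite /dot mxE; apply: eq_bigr => i _; rewrite mxE. Qed.

Lemma dotC u v : dot u v = dot v u.
Proof. by rewrite !dotE; apply: eq_bigr => i _; rewrite mulrC. Qed.

Lemma dotDr u v x : dot u (v + x) = dot u v + dot u x.
Proof. by rewrite /dot mulmxDr mxE. Qed.

Lemma dotZr a u v : dot u (a *: v) = a * dot u v.
Proof. by rewrite /dot -scalemxAr mxE. Qed.

Lemma dotNr u v : dot u (- v) = - dot u v.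
Proof. by rewrite -scaleN1r dotZr mulN1r. Qed.

Lemma dotBr u v x : dot u (v - x) = dot u v - dot u x.
Proof. by rewrite dotDr dotNr. Qed.

Lemma dot0r u : dot u 0 = 0.
Proof. by rewrite /dot mulmx0 mxE. Qed.

Lemma dotDl u v x : dot (u + v) x = dot u x + dot v x.
Proof. by rewrite ![dot _ x]dotC dotDr. Qed.

Lemma dotZl a u v : dot (a *: u) v = a * dot u v.
Proof. by rewrite ![dot _ v]dotC dotZr. Qed.

Lemma dotNl u v : dot (- u) v = - dot u v.
Proof. by rewrite ![dot _ v]dotC dotNr. Qed.

Lemma dotBl u v x : dot (u - v) x = dot u x - dot v x.
Proof. by rewrite dotDl dotNl. Qed.

Lemma dot0l u : dot 0 u = 0.
Proof. by rewrite dotC dot0r. Qed.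

Lemma dot_sumr (I : Type) (s : seq I) (Q : pred I) (f : I -> 'cV[R]_d) u :
  dot u (\sum_(i <- s | Q i) f i) = \sum_(i <- s | Q i) dot u (f i).
Proof.
by apply: (big_morph (dot u)) => [x y|]; rewrite ?dotDr ?dot0r.
Qed.

Lemma dot_suml (I : Type) (s : seq I) (Q : pred I) (f : I -> 'cV[R]_d) u :
  dot (\sum_(i <- s | Q i) f i) u = \sum_(i <- s | Q i) dot (f i) u.
Proof. by rewrite dotC dot_sumr; apply: eq_bigr => i _; rewrite dotC. Qed.

Lemma dot_mulmxr A u v : dot u (A *m v) = dot (A^T *m u) v.
Proof. by rewrite /dot trmx_mul trmxK mulmxA. Qed.

Lemma dot_sym A u v : A^T = A -> dot u (A *m v) = dot (A *m u) v.
Proof. by move=> sA; rewrite dot_mulmxr sA. Qed.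

Lemma dot_ge0 u : 0 <= dot u u.
Proof. by rewrite dotE sumr_ge0// => i _; rewrite -expr2 sqr_ge0. Qed.

Lemma dot_eq0 u : (dot u u == 0) = (u == 0).
Proof.
apply/eqP/eqP => [|->]; last by rewrite dot0r.
rewrite dotE => /psumr_eq0P u0; apply/colP => i; rewrite mxE; apply/eqP.
by rewrite -[_ == 0]orbb -mulf_eq0 u0// => j _; rewrite -expr2 sqr_ge0.
Qed.

Lemma enormE u : enorm u = Num.sqrt (dot u u).
Proof. by congr Num.sqrt; rewrite dotE. Qed.

Lemma enorm_ge0 u : 0 <= enorm u. Proof. exact: sqrtr_ge0. Qed.

Lemma sqr_enorm u : enorm u ^+ 2 = dot u u.
Proof. by rewrite enormE sqr_sqrtr ?dot_ge0. Qed.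

Lemma enorm0 : enorm (0 : 'cV[R]_d) = 0.
Proof. by rewrite enormE dot0r sqrtr0. Qed.

Lemma enorm_eq0 u : (enorm u == 0) = (u == 0).
Proof. by rewrite -dot_eq0 -sqr_enorm sqrf_eq0. Qed.

Lemma enormZ a u : enorm (a *: u) = `|a| * enorm u.
Proof.
by rewrite !enormE dotZl dotZr mulrA -expr2 sqrtrM ?sqr_ge0// sqrtr_sqr.
Qed.

Lemma enormN u : enorm (- u) = enorm u.
Proof. by rewrite -scaleN1r enormZ normrN normr1 mul1r. Qed.

Lemma psdE A : psd A <-> A^T = A /\ forall v, 0 <= dot v (A *m v).
Proof.
by split=> -[sA pA]; split=> // v; have := pA v; rewrite /dot mulmxA.
Qed.

(** The quadratic [t -> a + 2 t b + t^2 c] is nonnegative; its value at the minimizer [- b / c]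
    gives the inequality. If [c = 0] it is affine in [t], and [b != 0] would let it reach -1. *)
Lemma psd_cauchy_schwarz A u v : psd A ->
  dot u (A *m v) ^+ 2 <= dot u (A *m u) * dot v (A *m v).
Proof.
move=> /psdE[sA pA].
set a := dot u (A *m u); set b := dot u (A *m v); set c := dot v (A *m v).
have vu : dot v (A *m u) = b by rewrite dot_sym// dotC.
have H t : 0 <= a + 2 * t * b + t ^+ 2 * c.
  have := pA (u + t *: v).
  rewrite mulmxDr -scalemxAr !(dotDl, dotDr) !(dotZl, dotZr) vu -/a -/b -/c.
  by congr (_ <= _); ring.
have c0 : 0 <= c := pA v.
have [c00|cn0] := eqVneq c 0.
  have [->|b0] := eqVneq b 0; first by rewrite c00 mulr0 expr0n.
  have := H (- (a + 1) / (2 * b)); rewrite c00.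
  have -> : a + 2 * (- (a + 1) / (2 * b)) * b +
      (- (a + 1) / (2 * b)) ^+ 2 * 0 = -1 by field.
  by rewrite oppr_ge0 ler10.
have := H (- b / c).
have -> : a + 2 * (- b / c) * b + (- b / c) ^+ 2 * c = (a * c - b ^+ 2) / c.
  by field.
by rewrite pmulr_lge0 ?subr_ge0// invr_gt0 lt_def cn0.
Qed.

Lemma psd1 : psd (1%:M : 'M[R]_d).
Proof. by apply/psdE; rewrite trmx1; split=> // v; rewrite mul1mx dot_ge0. Qed.

Lemma cauchy_schwarz u v : dot u v <= enorm u * enorm v.
Proof.
have := psd_cauchy_schwarz u v psd1; rewrite !mul1mx -!sqr_enorm -exprMn => h.
apply: le_trans (ler_norm _) _; rewrite -ler_sqr ?nnegrE ?mulr_ge0 ?enorm_ge0//.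
by rewrite real_normK ?num_real.
Qed.

Lemma enorm_triangle u v : enorm (u + v) <= enorm u + enorm v.
Proof.
rewrite -ler_sqr ?nnegrE ?addr_ge0 ?enorm_ge0// sqr_enorm dotDl !dotDr.
rewrite sqrrD !sqr_enorm [dot v u]dotC.
have := cauchy_schwarz u v; lra.
Qed.

(** A crude entrywise constant is enough: it shows that the set under the supremum in
    [spectral_norm] is bounded above, so that this supremum is a genuine upper bound. *)
Lemma enorm_mulmx_bounded A : exists2 C, 0 <= C & forall x, enorm (A *m x) <= C * enorm x.
Proof.
exists (\sum_i \sum_j `|A i j|); first by rewrite !sumr_ge0// => i _; rewrite sumr_ge0.
move=> x.
have x_le j : `|x j 0| <= enorm x.
  rewrite -ler_sqr ?nnegrE ?enorm_ge0// real_normK ?num_real// sqr_enorm dotE.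
  rewrite (bigD1 j)//= -expr2 lerDl sumr_ge0// => i _; rewrite -expr2 sqr_ge0 //.
have le1 v : enorm v <= \sum_i `|v i 0|.
  rewrite -ler_sqr ?nnegrE ?enorm_ge0 ?sumr_ge0// sqr_enorm dotE expr2 mulr_suml.
  apply: ler_sum => i _; apply: le_trans (ler_norm _) _.
  by rewrite normrM ler_wpM2l// (bigD1 i)//= lerDl sumr_ge0.
apply: le_trans (le1 _) _; rewrite mulr_suml; apply: ler_sum => i _.
rewrite mxE mulr_suml; apply: le_trans (ler_norm_sum _ _ _) _.
by apply: ler_sum => j _; rewrite normrM ler_wpM2l.
Qed.

Lemma enorm_mulmx A x : enorm (A *m x) <= spectral_norm A * enorm x.
Proof.
have [->|x0] := eqVneq x 0; first by rewrite mulmx0 enorm0 mulr0.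
have nx : 0 < enorm x by rewrite lt_def enorm_eq0 x0 enorm_ge0.
have [C C0 HC] := enorm_mulmx_bounded A.
rewrite -ler_pdivrMr// -[_ / _]/(enorm (A *m x) * (enorm x)^-1).
have -> : enorm (A *m x) * (enorm x)^-1 = enorm (A *m ((enorm x)^-1 *: x)).
  by rewrite -scalemxAr enormZ ger0_norm ?invr_ge0 ?enorm_ge0// mulrC.
apply: ub_le_sup.
  exists C => _ [y /= y1 <-]; apply: le_trans (HC y) _.
  by rewrite -[leRHS]mulr1 ler_wpM2l.
exists ((enorm x)^-1 *: x) => //=.
by rewrite enormZ ger0_norm ?invr_ge0 ?enorm_ge0// mulVf// gt_eqF.
Qed.

End Euclid.

(** * Conjugate gradients *)

Section ConjugateGradient.
Context {R : realType} {d : nat}.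
Variables (A : 'M[R]_d.+1) (b : 'cV[R]_d.+1).
Hypothesis symA : A^T = A.
Hypothesis posA : forall v : 'cV[R]_d.+1, v != 0 -> 0 < dot v (A *m v).
Implicit Types (x y z : 'cV[R]_d.+1).

(** The span of [b, A b, ..., A^(k-1) b], in polynomial form so that a bound on the CG error becomes
    the choice of a polynomial. *)
Definition krylov k y := exists2 p : {poly R}, (size p <= k)%N & y = horner_mx A p *m b.

Lemma krylov0 z : krylov 0 z -> z = 0.
Proof. by case=> p; rewrite leqn0 size_poly_eq0 => /eqP-> ->; rewrite rmorph0 mul0mx. Qed.

Lemma krylovW k z : krylov k z -> krylov k.+1 z.
Proof. by case=> p sp ->; exists p => //; exact: leqW. Qed.

Lemma krylovD k y z : krylov k y -> krylov k z -> krylov k (y + z).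
Proof.
move=> [p sp ->] [q sq ->]; exists (p + q); last by rewrite rmorphD mulmxDl.
by rewrite (leq_trans (size_polyD _ _))// geq_max sp.
Qed.

Lemma krylovZ k a z : krylov k z -> krylov k (a *: z).
Proof.
move=> [p sp ->]; exists (a *: p); last by rewrite horner_mxZ scalemxAl.
by rewrite (leq_trans (size_scale_leq _ _)).
Qed.

Lemma krylovB k y z : krylov k y -> krylov k z -> krylov k (y - z).
Proof. by move=> ky kz; rewrite -scaleN1r; apply/krylovD/krylovZ. Qed.

Lemma krylov_mul k z : krylov k z -> krylov k.+1 (A *m z).
Proof.
move=> [p sp ->]; exists ('X * p).
  by rewrite mulrC (leq_trans (size_polyMleq _ _))// size_polyX addn2 /= ltnS.
by rewrite rmorphM /= horner_mx_X -mulmxA.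
Qed.

Lemma krylov_b : krylov 1 b.
Proof. by exists 1; rewrite ?size_poly1// rmorph1 mul1mx. Qed.

(* A direction conjugate to [krylov k] has degree exactly [k] in [A], for
   otherwise it would be conjugate to itself. *)
Lemma krylov_split k dir y : krylov k.+1 dir -> dir != 0 ->
  (forall z, krylov k z -> dot dir (A *m z) = 0) -> krylov k.+1 y ->
  exists2 z, krylov k z & exists c, y = z + c *: dir.
Proof.
have drop_top (p : {poly R}) : (size p <= k.+1)%N -> p`_k = 0 -> (size p <= k)%N.
  move=> sp pk; apply/leq_sizeP => j; rewrite leq_eqVlt => /predU1P[<-//|kj].
  by move/leq_sizeP: sp; apply.
move=> [p sp dirE] dir0 orth [u su ->].
have pk0 : p`_k != 0.
  apply/negP => /eqP pk; have := posA dir0; rewrite orth ?ltxx//.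
  by exists p => //; exact: drop_top.
pose c := u`_k / p`_k.
exists (horner_mx A (u - c *: p) *m b).
  exists (u - c *: p) => //; apply: drop_top; last first.
    by rewrite coefB coefZ /c divfK// subrr.
  rewrite (leq_trans (size_polyD _ _))// geq_max su size_polyN.
  by rewrite (leq_trans (size_scale_leq _ _)).
by exists c; rewrite dirE rmorphB /= horner_mxZ mulmxBl -scalemxAl subrK.
Qed.

(** The residual is orthogonal, and the direction [A]-conjugate, to the Krylov space. The last
    equation identifies the step length of [cg_step] with that of an exact line search along
    [dir]. *)
Definition cg_optimal k (st : 'cV[R]_d.+1 * 'cV[R]_d.+1 * 'cV[R]_d.+1) :=
  let: (x, res, dir) := st in
  [/\ krylov k x, krylov k.+1 dir,
      forall z, krylov k z -> dot res z = 0,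
      forall z, krylov k z -> dot dir (A *m z) = 0
    & dot dir res = dot res res].

(** A zero residual is a separate alternative: the iterate is then exact and stays put, and the
    quotients of [cg_step] have a zero denominator. *)
Definition cg_inv k st :=
  st.1.2 = b - A *m st.1.1 /\ (st.1.2 = 0 \/ cg_optimal k st).

(** By [krylov_split], the new relations need testing only on the old Krylov space, where the old
    invariant helps, and on [dir], where the choice of [a] and [b'] does. *)
Lemma cg_inv_step k st : cg_inv k st -> cg_inv k.+1 (cg_step A st).
Proof.
case: st => [[x res] dir]; rewrite /cg_inv /=.
rewrite -[((res)^T *m res) 0 0]/(dot res res).
rewrite -mulmxA -[(_ *m (A *m dir)) 0 0]/(dot dir (A *m dir)).
set a := _ / dot dir _; set res' := res - _.
rewrite -[((res')^T *m res') 0 0]/(dot res' res'); set b' := _ / dot res _.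
move=> [resE H]; have res'E : res' = b - A *m (x + a *: dir).
  by rewrite /res' resE mulmxDr -scalemxAr opprD addrA.
split=> //; have [res0|res0] := eqVneq res 0.
  left; rewrite /res' /a res0 dot0r mul0r scale0r subr0 //.
have [res'0|res'0] := eqVneq res' 0; [by left|right].
case: H => [/eqP|[kx kdir ores odir dirres]]; first by rewrite (negPf res0).
have rr0 : dot res res != 0 by rewrite dot_eq0.
have dir0 : dir != 0.
  by apply: contra_neq rr0 => dir0; rewrite -dirres dir0 dot0l.
have dAd0 : dot dir (A *m dir) != 0 by rewrite gt_eqF ?posA.
have a0 : a != 0 by rewrite mulf_neq0 ?invr_neq0.
have kres : krylov k.+1 res.
  rewrite resE; apply: krylovB; last exact: krylov_mul.
  by case: krylov_b => p sp ->; exists p => //; exact: leq_trans sp _.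
have ores' z : krylov k.+1 z -> dot res' z = 0.
  move=> /(krylov_split kdir dir0 odir)[{}z kz [c ->]].
  rewrite dotDr dotZr /res' !dotBl !dotZl ores// -!(dot_sym _ _ symA) odir//.
  by rewrite [dot res dir]dotC dirres /a; field.
(* As [A dir] is a multiple of a difference of residuals, conjugacy to [dir] reduces to
   orthogonality of residuals. *)
have AdirE : A *m dir = a^-1 *: (res - res').
  by rewrite /res' opprB addrCA subrr addr0 scalerA mulVf// scale1r.
have kres' : krylov k.+2 res'.
  apply: krylovB; first exact: krylovW.
  by apply/krylovZ/krylov_mul.
clearbody res'.
have kx' : krylov k.+1 (x + a *: dir) by apply: krylovD; [exact: krylovW|exact: krylovZ].
have kdir' : krylov k.+2 (res' + b' *: dir).
  by apply: krylovD => //; exact/krylovZ/krylovW.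
split=> //.
  move=> z /(krylov_split kdir dir0 odir)[{}z kz [c ->]].
  rewrite mulmxDr -scalemxAr dotDr dotZr !dotDl !dotZl (odir z kz).
  rewrite (ores' _ (krylov_mul kz)).
  rewrite AdirE !dotZr !dotBr ores'// (_ : dot dir res' = 0); last by rewrite dotC ores'.
  by rewrite dirres /b'; field; rewrite a0.
by rewrite dotDl dotZl [dot dir _]dotC (ores' _ kdir) mulr0 addr0.
Qed.

Lemma cg_invP k : cg_inv k (iter k (cg_step A) (0, b, b)).
Proof.
elim: k => [|k IH]; last by rewrite iterS; exact: cg_inv_step.
split=> /=; first by rewrite mulmx0 subr0.
right; split=> //.
- by exists 0; rewrite ?size_poly0// rmorph0 mul0mx.
- exact: krylov_b.
- by move=> z /krylov0->; rewrite dot0r.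
- by move=> z /krylov0->; rewrite mulmx0 dot0r.
Qed.

(** Pythagoras in the energy norm: [A (xs - x)] is the residual, which is orthogonal to the Krylov
    vector [x - z], so the cross terms vanish. *)
Lemma cg_minimizes k xs z : A *m xs = b -> krylov k z ->
  dot (xs - cg A b k) (A *m (xs - cg A b k)) <= dot (xs - z) (A *m (xs - z)).
Proof.
move=> Axs kz; rewrite /cg; have := cg_invP k.
case: (iter _ _ _) => [[x res] dir] [/= resE H].
have Ae : A *m (xs - x) = res by rewrite mulmxBr Axs.
have pA y : 0 <= dot y (A *m y).
  by have [->|/posA/ltW//] := eqVneq y 0; rewrite dot0l.
rewrite Ae; case: H => [->|[kx _ ores _ _]]; first by rewrite dot0r pA.
have -> : xs - z = (xs - x) + (x - z) by rewrite addrA subrK.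
move: (xs - x) Ae => e Ae; have ores' := ores _ (krylovB kx kz).
rewrite mulmxDr Ae dotDl !dotDr (dot_sym e _ symA) Ae ores'.
by rewrite [dot (x - z) res]dotC ores' add0r addr0 lerDl.
Qed.

(** Since [Q(0) = 1], [Q = 1 - q X] with [q] of degree below [k], so [Q(A) xs = xs - q(A) b] is the
    error of a competitor in the Krylov space. *)
Lemma cg_poly_bound k xs (Q : {poly R}) : A *m xs = b ->
  (size Q <= k.+1)%N -> Q`_0 = 1 ->
  dot (xs - cg A b k) (A *m (xs - cg A b k)) <=
  dot (horner_mx A Q *m xs) (A *m (horner_mx A Q *m xs)).
Proof.
move=> Axs sQ Q0.
have XE : 1 - Q = (1 - Q) %/ 'X * 'X.
  apply/esym/divpK; rewrite -[X in X %| _]subr0 -[0]/(0%:P) dvdp_XsubCl.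
  by rewrite rootE horner_coef0 coefB coef1 Q0 subrr.
set q := _ %/ _ in XE.
have := @cg_minimizes k xs (horner_mx A q *m b) Axs.
have -> : xs - horner_mx A q *m b = horner_mx A Q *m xs.
  have qXE : horner_mx A (q * 'X) = horner_mx A q *m A.
    by rewrite rmorphM /= horner_mx_X.
  rewrite -Axs mulmxA -qXE.
  by rewrite -XE rmorphB rmorph1 mulmxBl mul1mx opprB addrC subrK.
apply; exists q => //.
rewrite /q size_divp ?polyX_eq0// size_polyX /= leq_subLR add1n.
rewrite (leq_trans (size_polyD _ _))// size_polyN size_poly1 geq_max sQ.
by [].
Qed.

End ConjugateGradient.

(** * Spectral calculus of real symmetric matrices *)

Lemma normalmx_spectral (C : numClosedFieldType) (n : nat) (A : 'M[C]_n.+1) :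
  A \is normalmx -> exists P : 'M[C]_n.+1, exists2 sp : 'rV[C]_n.+1,
    (forall g, horner_mx A g = (P ^t*)%sesqui *m diag_mx (map_mx (horner g) sp) *m P) &
    (forall j, root (char_poly A) (sp 0 j)).
Proof.
move=> /orthomx_spectralP AE.
have PU := spectral_unitarymx A; have Pu := spectral_unit A.
move: (spectralmx A) (spectral_diag A) AE PU Pu => P sp AE PU Pu.
have AfE g : horner_mx A g = invmx P *m diag_mx (map_mx (horner g) sp) *m P.
  by rewrite AE horner_mx_uconjC// horner_mx_diag.
exists P, sp => [g|j]; first by rewrite AfE invmx_unitary.
(* For [g] the characteristic polynomial, the diagonal matrix of the values [g (sp j)] is conjugate
   to 0, hence is 0. *)
have := Cayley_Hamilton A; rewrite AfE.
move=> /(congr1 (fun M => P *m M *m invmx P)); rewrite mulmx0 mul0mx.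
rewrite !mulmxA mulmxV// mul1mx mulmxK// => /matrixP/(_ j j).
by rewrite !mxE eqxx mulr1n rootE => ->.
Qed.

Section RealSpectral.
Context {R : realType} {d : nat}.
Local Notation C := R[i].
Local Notation toC := (real_complex R).
Local Notation mxC := (map_mx toC).

(* Over R[i] the matrix is unitarily diagonal, and by Cayley-Hamilton its
   diagonal entries are among the [lambda]. *)
Lemma horner_mx_quad_ge0 (A : 'M[R]_d.+1) (lambda : seq R) (f : {poly R})
    (x : 'cV[R]_d.+1) :
  A^T = A -> char_poly A = \prod_(l <- lambda) ('X - l%:P) ->
  (forall l, l \in lambda -> 0 <= f.[l]) -> 0 <= dot x (horner_mx A f *m x).
Proof.
move=> symA chA f_ge0; pose Ac : 'M[C]_d.+1 := mxC A.
have realC m n (B : 'M[R]_(m, n)) : mxC B \is a realmx.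
  by apply/mxOverP => i j; rewrite mxE; apply/complex_realP; exists (B i j).
have nA : Ac \is normalmx.
  apply: (@symmetric_normalmx C) (realC _ _ _); rewrite is_hermitianmxE; apply/eqP.
  by rewrite expr0 scale1r map_mx_id// map_trmx symA.
have [P [sp AfE sp_root']] := normalmx_spectral nA.
have sp_root j : exists2 l, l \in lambda & sp 0 j = l%:C%C.
  have := sp_root' j; rewrite -map_char_poly.
  rewrite chA rmorph_prod /=.
  under eq_bigr do rewrite rmorphB /= map_polyX map_polyC /=.
  rewrite -(big_map (fun l : R => l%:C%C) predT (fun z => 'X - z%:P)).
  by rewrite root_prod_XsubC => /mapP[l ll ->]; exists l.
rewrite -ler0c; pose xc : 'cV[C]_d.+1 := mxC x.
have -> : (dot x (horner_mx A f *m x))%:C%C =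
    (xc^T *m (horner_mx Ac (map_poly toC f) *m xc)) 0 0.
  by rewrite -map_horner_mx -map_mxM map_trmx -map_mxM mxE.
rewrite AfE -!mulmxA (mulmxA _ (P ^t*)%sesqui).
have -> : (xc^T *m P ^t*)%sesqui = ((P *m xc) ^t*)%sesqui.
  by rewrite -{1}(realmxC (realC _ _ x) : map_mx Num.conj xc = xc) map_trmx -map_mxM -trmx_mul.
(* With [z = P xc], the form is the sum of the terms [f (sp j) |z_j|^2]. *)
rewrite mxE sumr_ge0// => j _; rewrite mul_diag_mx !mxE.
have [l /f_ge0 fl ->] := sp_root j.
by rewrite horner_map /= mulrCA mulr_ge0 ?ler0c// mulrC mul_conjC_ge0.
Qed.

End RealSpectral.

(** * Convergence rate of conjugate gradients *)

Section Rate.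
Context {R : realType} {d : nat}.
Implicit Types (A : 'M[R]_d.+1) (lambda : seq R) (x : 'cV[R]_d.+1).

Lemma trmx_horner_mx A (p : {poly R}) : A^T = A ->
  (horner_mx A p)^T = horner_mx A p.
Proof.
move=> sA; elim/poly_ind: p => [|p c IH]; first by rewrite rmorph0 trmx0.
have comm : A *m horner_mx A p = horner_mx A p *m A.
  exact/comm_mx_horner/comm_mx_refl.
rewrite rmorphD rmorphM /= horner_mx_X horner_mx_C raddfD /= trmx_mul tr_scalar_mx.
by rewrite IH sA comm.
Qed.

Lemma spectrum_gt0 A lambda l : A^T = A ->
  (forall v : 'cV[R]_d.+1, v != 0 -> 0 < dot v (A *m v)) ->
  char_poly A = \prod_(l <- lambda) ('X - l%:P) -> l \in lambda -> 0 < l.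
Proof.
move=> sA pA chA ll; have : eigenvalue A l.
  by rewrite eigenvalue_root_char chA root_prod_XsubC.
case/eigenvalueP => v vA v0; have u0 : v^T != 0 by rewrite trmx_eq0.
have := pA _ u0; rewrite -[A]sA -trmx_mul vA linearZ /= dotZr.
by rewrite pmulr_lgt0// lt_def dot_eq0 u0 dot_ge0.
Qed.

Lemma size_spectrum A lambda :
  char_poly A = \prod_(l <- lambda) ('X - l%:P) -> size lambda = d.+1.
Proof.
by move=> /(congr1 (fun p : {poly R} => size p)); rewrite size_char_poly size_prod_XsubC => -[].
Qed.

(* The linear factor is centred on the retained interval
   [lambda_1, lambda_(d-r+1)]; the others annihilate the larger eigenvalues. *)
Lemma cg_rate A b xs lambda r tol : A^T = A ->
  (forall v : 'cV[R]_d.+1, v != 0 -> 0 < dot v (A *m v)) ->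
  ordered_spectrum A lambda -> (1 <= r <= d.+1)%N -> A *m xs = b ->
  cg_ratio d.+1 lambda r <= tol ->
  let e := xs - cg A b r in
  dot e (A *m e) <= tol ^+ 2 * dot xs (A *m xs).
Proof.
move=> sA pA [srt chA] /andP[r1 rd] Axs rho_tol /=.
have szl := size_spectrum chA.
have lgt0 l : l \in lambda -> 0 < l by exact: spectrum_gt0 chA.
(* [m] is the zero-based position of the largest retained eigenvalue. Exactly [r - 1] entries of
   [lambda] follow it, so [Q] below has degree at most [r]. *)
pose m := (d.+1 - r)%N; have md : (m < d.+1)%N by rewrite ltn_subrL r1.
pose l1 := lambda`_0; pose lm := lambda`_m.
have nth_mono i j : (i <= j)%N -> (j < d.+1)%N -> lambda`_i <= lambda`_j.
  move=> ij jd; apply: (sorted_leq_nth le_trans lexx) => //; rewrite inE szl//.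
  exact: leq_ltn_trans jd.
have l1gt0 : 0 < l1 by rewrite lgt0// mem_nth// szl.
have lmgt0 : 0 < lm by rewrite lgt0// mem_nth// szl.
(* Together with [fA], this turns an energy bound on [P(A) xs] into the scalar inequality
   [P(l)^2 <= c] on the spectrum. *)
have fE (P : {poly R}) c l : ('X * c%:P - P * 'X * P).[l] = l * (c - P.[l] ^+ 2).
  by rewrite !hornerE /=; ring.
have fA (P : {poly R}) c : dot xs (horner_mx A ('X * c%:P - P * 'X * P) *m xs) =
    c * dot xs (A *m xs) - dot (horner_mx A P *m xs) (A *m (horner_mx A P *m xs)).
  rewrite rmorphB !rmorphM /= horner_mx_X horner_mx_C mulmxBl dotBr.
  rewrite -!mulmxE -!mulmxA mul_scalar_mx -scalemxAr dotZr.
  by rewrite (dot_sym xs _ (trmx_horner_mx P sA)).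
set rho := cg_ratio _ _ _ in rho_tol *; have rhoE : rho = (lm - l1) / (lm + l1) by [].
pose Q : {poly R} := (1 - (2 / (l1 + lm)) *: 'X) *
  \prod_(l <- drop m.+1 lambda) (1 - l^-1 *: 'X).
have size_fac (c : R) : (size (1 - c *: 'X : {poly R})%R <= 2)%N.
  rewrite (leq_trans (size_polyD _ _))// geq_max size_poly1 size_polyN /=.
  by rewrite (leq_trans (size_scale_leq _ _))// size_polyX.
have sQ : (size Q <= r.+1)%N.
  have size_prod (s : seq R) :
      (size (\prod_(l <- s) (1 - l^-1 *: 'X) : {poly R})%R <= (size s).+1)%N.
    elim: s => [|a s IH]; first by rewrite big_nil size_poly1.
    rewrite big_cons (leq_trans (size_polyMleq _ _))//.
    by rewrite -subn1 leq_subLR (leq_trans (leq_add (size_fac _) IH)).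
  rewrite /Q (leq_trans (size_polyMleq _ _))// -subn1 leq_subLR.
  rewrite (leq_trans (leq_add (size_fac _) (size_prod _)))// size_drop szl.
  by rewrite /m; lia.
have Q0 : Q`_0 = 1.
  by rewrite -horner_coef0 hornerM horner_prod big1 => [|l _];
    rewrite !hornerE/= ?mulr0 ?subr0 ?mulr1.
apply: le_trans (cg_poly_bound sA pA Axs sQ Q0) _.
have rho0 : 0 <= rho.
  by rewrite rhoE divr_ge0 ?subr_ge0 ?nth_mono// ltW// addr_gt0.
apply: (@le_trans _ _ (rho ^+ 2 * dot xs (A *m xs))); last first.
  apply: ler_wpM2r; last by rewrite lerXn2r ?nnegrE// (le_trans rho0).
  by have [->|/pA/ltW//] := eqVneq xs 0; rewrite dot0l.
pose f := 'X * (rho ^+ 2)%:P - Q * 'X * Q.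
have : 0 <= dot xs (horner_mx A f *m xs).
  apply: horner_mx_quad_ge0 sA chA _ => l ll.
  have l0 := lgt0 _ ll.
  have -> : f.[l] = l * (rho ^+ 2 - Q.[l] ^+ 2).
    exact: fE.
  rewrite mulr_ge0 ?(ltW l0)// subr_ge0.
  rewrite -[leLHS]real_normK ?num_real// lerXn2r ?nnegrE//.
  have : l \in take m.+1 lambda ++ drop m.+1 lambda by rewrite cat_take_drop.
  rewrite mem_cat => /orP[|ld]; last first.
    suff -> : Q.[l] = 0.
      by rewrite normr0.
    rewrite hornerM horner_prod; apply/eqP; rewrite mulf_eq0; apply/orP; right.
    rewrite prodf_seq_eq0; apply/hasP; exists l => //=.
    by rewrite !hornerE /= mulVf ?subrr// gt_eqF.
  case/(nthP 0) => i; rewrite size_take szl.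
  rewrite (_ : (if _ then _ else _) = m.+1); last by case: ifP => mlt; lia.
  move=> im; rewrite nth_take// => lE.
  have l1l : l1 <= l by rewrite -lE nth_mono//; lia.
  have llm : l <= lm by rewrite -lE nth_mono//; lia.
  rewrite hornerM normrM -[leRHS]mulr1 ler_pM//.
    rewrite !hornerE /= rhoE ler_norml.
    have -> : 1 - 2 / (l1 + lm) * l = (l1 + lm - 2 * l) / (lm + l1).
      by field; rewrite gt_eqF// addr_gt0.
    rewrite -mulNr !ler_pM2r ?invr_gt0 ?addr_gt0//.
    by apply/andP; split; lra.
  (* Each factor [1 - l / lambda_j] lies in [0, 1] because [l <= lm <= lambda_j]. *)
  rewrite horner_prod normr_prod big_seq; apply: prodr_ile1 => _ /(nthP 0)[j jd <-].
  rewrite normr_ge0 /= nth_drop; move: jd; rewrite size_drop szl => jd.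
  have jd' : (m.+1 + j < d.+1)%N by lia.
  have lj0 : 0 < lambda`_(m.+1 + j) by rewrite lgt0// mem_nth// szl.
  have llj : l <= lambda`_(m.+1 + j).
    by rewrite (le_trans llm)// nth_mono//; lia.
  rewrite !hornerE /= ger0_norm ?subr_ge0 ?ler_pdivrMl ?mulr1//.
  by rewrite lerBlDr lerDl mulr_ge0 ?invr_ge0 ?ltW.
by rewrite fA subr_ge0.
Qed.

End Rate.

(** * Differential calculus *)

Section Calculus.
Context {R : realType} {d : nat}.
Implicit Types (f : 'cV[R]_d -> R) (a e u v : 'cV[R]_d).

Lemma derive_partial f a e : differentiable f a ->
  'D_e f a = \sum_i e i 0 * partial i f a.
Proof.
move=> df; rewrite deriveE// {1}(matrix_sum_delta e) linear_sum; apply: eq_bigr => i _.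
by rewrite big_ord1 linearZ /= /partial deriveE.
Qed.

Lemma is_derive_line f a e (t : R) : differentiable f (a + t *: e) ->
  is_derive t (1 : R) (fun s : R => f (a + s *: e))
    (\sum_i e i 0 * partial i f (a + t *: e)).
Proof.
move=> df; rewrite -derive_partial//.
have H : (fun h : R => h^-1 *: (((fun s : R => f (a + s *: e)) \o shift t) (h *: 1) -
    f (a + t *: e))) =
    (fun h : R => h^-1 *: ((f \o shift (a + t *: e)) (h *: e) - f (a + t *: e))).
  apply/funext => h /=; congr (_ *: (f _ - _)).
  by rewrite scalerDl [h *: 1]mulr1 addrCA.
have := diff_derivable (v := e) df; rewrite /derivable -H => dg.
by apply: DeriveDef => //; rewrite /derive H.
Qed.

Lemma is_derive_gradient_line f a e u (t : R) :
  (forall i w, differentiable (partial i f) w) ->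
  is_derive t (1 : R) (fun s : R => dot u (gradient f (a + s *: e)))
    (dot e (hessian f (a + t *: e) *m u)).
Proof.
move=> df.
have -> : (fun s : R => dot u (gradient f (a + s *: e))) =
    \sum_(j < d) (fun s : R => u j 0 *: partial j f (a + s *: e)).
  apply/funext => s; rewrite fct_sumE dotE; apply: eq_bigr => j _.
  by rewrite mxE.
apply: is_derive_eq.
  apply: is_derive_sum => j; apply: is_deriveZ; exact: is_derive_line.
rewrite dotE; under [RHS]eq_bigr do rewrite mxE mulr_sumr.
rewrite exchange_big /=; apply: eq_bigr => j _; rewrite [LHS]mulr_sumr.
by apply: eq_bigr => i _; rewrite mxE [RHS]mulrA [RHS]mulrC.
Qed.

Lemma is_derive_continuous (f : R -> R) (df : R -> R) :
  (forall t : R, is_derive t (1 : R) f (df t)) -> continuous f.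
Proof.
move=> H t; apply: differentiable_continuous; apply/derivable1_diffP.
by have := H t; case.
Qed.

(** Pairing with a fixed [u] reduces the vector case to the scalar mean value theorem, at the price
    of a [t] that depends on [u]. *)
Lemma gradient_mvt f a e u :
  (forall i w, differentiable (partial i f) w) ->
  exists t, dot u (gradient f (a + e)) - dot u (gradient f a) =
    dot e (hessian f (a + t *: e) *m u).
Proof.
move=> df; have H t := is_derive_gradient_line a e u t df.
have [//|t _] := MVT (@ltr01 R) (fun t _ => H t).
  exact/continuous_subspaceT/(is_derive_continuous H).
by rewrite scale1r scale0r addr0 subr0 mulr1 => ?; exists t.
Qed.

(* Compares [t |-> u . gradient f (a + t e)] with its quadratic majorant at
   [t = 1]; testing it with [u] the remainder itself bounds the remainder. *)
Lemma gradient_taylor f a w (M : R) :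
  (forall i z, differentiable (partial i f) z) ->
  (forall z, (hessian f z)^T = hessian f z) ->
  0 <= M ->
  (forall v z, spectral_norm (hessian f v - hessian f z) <= M * enorm (v - z)) ->
  enorm (gradient f w - gradient f a - hessian f w *m (w - a)) <=
    M / 2 * enorm (w - a) ^+ 2.
Proof.
move=> df sH M0 lipH.
have [e eE] : exists e, w - a = e by eexists.
have ae : a + e = w by rewrite -eE addrCA subrr addr0.
rewrite eE.
have [u uE] : exists u, u = gradient f w - gradient f a - hessian f w *m e by eexists.
have [c cE] : exists c, c = dot u (hessian f w *m e) by eexists.
have splitc (A : 'M[R]_d) : dot u (A *m e) = c + dot u ((A - hessian f w) *m e).
  by rewrite cE mulmxBl dotBr addrCA subrr addr0.
rewrite -uE; pose K := M * enorm e ^+ 2 * enorm u.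
(* [K] makes [psi' <= 0] on (0, 1), since the Hessians at [a + t e] and at [w] differ by at most
   [M (1 - t) |e|]. The mean value theorem then yields [psi 1 <= psi 0], that is
   [u . u <= K / 2]. *)
pose psi := fun t : R => dot u (gradient f (a + t *: e)) - t * (c + K) + (K / 2) * t ^+ 2.
have dpsi (t : R) : is_derive t (1 : R) psi
    (dot e (hessian f (a + t *: e) *m u) - (c + K) + K * t).
  have H := is_derive_gradient_line a e u t df.
  have -> : psi = (fun s => dot u (gradient f (a + s *: e))) - (c + K) \*: id +
      (K / 2) \*: (id ^+ 2).
    by apply/funext => s; rewrite /psi /= mulrC.
  apply: is_derive_eq; rewrite /= expr1.
  rewrite /GRing.scale /=; by field.
have [t t01] := MVT (@ltr01 R) (fun t _ => dpsi t)
   (continuous_subspaceT (is_derive_continuous dpsi)).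
rewrite subr0 mulr1 /psi scale1r scale0r addr0 ae mul0r subr0 mul1r expr1n expr0n mulr0 addr0.
rewrite (dot_sym e u (sH _)) [dot _ u]dotC splitc => E.
have : dot u ((hessian f (a + t *: e) - hessian f w) *m e) <= K * (1 - t).
  apply: le_trans (cauchy_schwarz _ _) _.
  rewrite mulrC /K -mulrA [_ * (1 - t)]mulrC mulrA ler_wpM2r ?enorm_ge0//.
  apply: le_trans (enorm_mulmx _ _) _; apply: le_trans (ler_wpM2r (enorm_ge0 _) (lipH _ _)) _.
  have -> : a + t *: e - w = (t - 1) *: e.
    by rewrite -ae opprD addrACA subrr add0r scalerBl scale1r.
  move: t01; rewrite in_itv /= => /andP[t0 t1].
  rewrite enormZ distrC ger0_norm ?subr_ge0 ?(ltW t1)//.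
  by rewrite le_eqVlt; apply/orP; left; apply/eqP; ring.
move: (dot u (_ *m e)) E => q E le1.
have : dot u u <= K / 2.
  rewrite {2}uE !dotBr -cE; move: E le1; lra.
rewrite -sqr_enorm /K => le2.
have [->|u0] := eqVneq (enorm u) 0; first by rewrite mulr_ge0 ?divr_ge0 ?sqr_ge0.
have upos : 0 < enorm u by rewrite lt_def u0 enorm_ge0.
rewrite -(ler_pM2r upos) -expr2 (le_trans le2)//.
by rewrite le_eqVlt; apply/orP; left; apply/eqP; ring.
Qed.

End Calculus.

(** * Derivatives of the average, and the gradient at a minimizer *)

Section Average.
Context {R : realType} {d n : nat}.
Variable F : 'I_n -> 'cV[R]_d -> R.
Hypothesis F_C2 : forall i, twice_continuously_differentiable (F i).

Lemma averageE (G : 'I_n -> 'cV[R]_d -> R) : average G = n%:R^-1 \*: \sum_(i < n) G i.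
Proof. by apply/funext => w; rewrite /average /= fct_sumE. Qed.

Lemma differentiable_average (G : 'I_n -> 'cV[R]_d -> R) w :
  (forall i, differentiable (G i) w) -> differentiable (average G) w.
Proof.
by move=> dG; rewrite averageE; apply: differentiableZ; exact: differentiable_sum.
Qed.

Lemma partial_average (G : 'I_n -> 'cV[R]_d -> R) j :
  (forall i w, differentiable (G i) w) ->
  partial j (average G) = average (fun i => partial j (G i)).
Proof.
move=> dG; apply/funext => w; rewrite averageE /partial deriveZ; last first.
  by apply: derivable_sum => i; exact/diff_derivable.
by rewrite derive_sum// => i; exact/diff_derivable.
Qed.

Lemma differentiable_partial_average j w : differentiable (partial j (average F)) w.
Proof.
rewrite partial_average => [|i v]; last by case: (F_C2 i).
by apply: differentiable_average => i; case: (F_C2 i).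
Qed.

Lemma hessian_average w :
  hessian (average F) w = n%:R^-1 *: \sum_(i < n) hessian (F i) w.
Proof.
apply/matrixP => i j; rewrite !mxE summxE partial_average; last first.
  by move=> k v; case: (F_C2 k).
rewrite partial_average /average => [|k v]; last by case: (F_C2 k).
by congr (_ * _); apply: eq_bigr => k _; rewrite mxE.
Qed.

End Average.

Lemma gradient_min {R : realType} {d : nat} (f : 'cV[R]_d -> R) w :
  (forall v, f w <= f v) -> (forall v, differentiable f v) -> gradient f w = 0.
Proof.
move=> fmin df; apply/colP => i; rewrite !mxE.
pose g := fun s : R => f (w + s *: delta_mx i 0).
have dg (t : R) := @is_derive_line _ _ f w (delta_mx i 0) t (df _).
have g0 : is_derive (0 : R) (1 : R) g 0.
  apply: (@derive1_at_min _ g (-1) 1) => //.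
  - by rewrite in_itv /= ltrN10 ltr01.
  - by move=> t _; rewrite /g scale0r addr0.
have := dg 0; rewrite scale0r addr0 -derive_partial// => g1.
by rewrite /partial -(@derive_val _ _ _ _ _ _ _ g1) (@derive_val _ _ _ _ _ _ _ g0).
Qed.

(** * Matrices with quadratic form between [mu] and [L] *)

Section Bounds.
Context {R : realType} {d : nat}.
Implicit Types (A : 'M[R]_d) (v : 'cV[R]_d) (mu L : R).

Definition quad_bounds mu L A := A^T = A /\
  forall v, mu * dot v v <= dot v (A *m v) <= L * dot v v.

Lemma loewner_quad_bounds mu L A :
  loewner_le mu%:M A /\ loewner_le A L%:M -> quad_bounds mu L A.
Proof.
move=> [/psdE[sA hmu] /psdE[_ hL]]; split.
  by move: sA; rewrite linearB /= tr_scalar_mx => /addIr.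
move=> v; have := hmu v; have := hL v.
by rewrite !mulmxBl !dotBr !mul_scalar_mx !dotZr !subr_ge0 => -> ->.
Qed.

Lemma quad_bounds_mean (I : Type) (s : seq I) (H : I -> 'M[R]_d) mu L :
  (0 < size s)%N -> (forall i, quad_bounds mu L (H i)) ->
  quad_bounds mu L ((size s)%:R^-1 *: \sum_(i <- s) H i).
Proof.
move=> s0 HH; split.
  rewrite linearZ linear_sum /=; congr (_ *: _); apply: eq_bigr => i _.
  by case: (HH i).
have s0' : 0 < (size s)%:R :> R by rewrite ltr0n.
have cst (c : R) : c * (size s)%:R = \sum_(i <- s) c.
  by rewrite big_const_seq count_predT iter_addr_0 mulr_natr.
move=> v; rewrite -scalemxAl dotZr mulmx_suml dot_sumr.
rewrite ler_pdivlMl// ler_pdivrMl// ![_%:R * _]mulrC !cst.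
by rewrite !ler_sum// => i _; have [_ /(_ v)/andP[]] := HH i.
Qed.

Variables (mu L : R) (A : 'M[R]_d).
Hypothesis mu0 : 0 < mu.
Hypothesis bA : quad_bounds mu L A.

Lemma quad_bounds_pos v : v != 0 -> 0 < dot v (A *m v).
Proof.
move=> v0; have /andP[+ _] := bA.2 v; apply: lt_le_trans.
by rewrite mulr_gt0// lt_def dot_eq0 v0 dot_ge0.
Qed.

Lemma quad_bounds_psd : psd A.
Proof.
apply/psdE; split; first exact: bA.1.
by move=> v; have [->|/quad_bounds_pos/ltW//] := eqVneq v 0; rewrite dot0l.
Qed.

Lemma enorm_mulmx_ge v : mu * enorm v <= enorm (A *m v).
Proof.
have [->|v0] := eqVneq v 0; first by rewrite enorm0 mulr0 enorm_ge0.
have nv : 0 < enorm v by rewrite lt_def enorm_eq0 v0 enorm_ge0.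
rewrite -(ler_pM2r nv) -mulrA -expr2 sqr_enorm mulrC.
have /andP[+ _] := bA.2 v; rewrite mulrC => /le_trans -> //.
by rewrite mulrC cauchy_schwarz.
Qed.

(** Cauchy-Schwarz for the form [A], applied to [A v] and [v], gives
    [|A v|^4 <= (L |A v|^2) (L |v|^2)]; it remains to cancel [|A v|^2]. *)
Lemma enorm_mulmx_le v : enorm (A *m v) <= L * enorm v.
Proof.
have [->|v0] := eqVneq v 0; first by rewrite mulmx0 enorm0 mulr0.
have nv : 0 < dot v v by rewrite lt_def dot_eq0 v0 dot_ge0.
have L0 : 0 <= L.
  have /andP[h1 h2] := bA.2 v; have := le_trans h1 h2.
  by rewrite ler_pM2r// => /(le_trans (ltW mu0)).
have [Av0|Av0] := eqVneq (A *m v) 0.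
  by rewrite Av0 enorm0 mulr_ge0 ?enorm_ge0.
have nAv : 0 < dot (A *m v) (A *m v) by rewrite lt_def dot_eq0 Av0 dot_ge0.
rewrite -ler_sqr ?nnegrE ?mulr_ge0 ?enorm_ge0// exprMn !sqr_enorm.
have := psd_cauchy_schwarz (A *m v) v quad_bounds_psd.
rewrite expr2 => h; rewrite -(ler_pM2r nAv) (le_trans h)//.
have /andP[_ h1] := bA.2 (A *m v); have /andP[_ h2] := bA.2 v.
have -> : L ^+ 2 * dot v v * dot (A *m v) (A *m v) =
  (L * dot (A *m v) (A *m v)) * (L * dot v v) by ring.
by have /psdE[_ pA] := quad_bounds_psd; apply: ler_pM.
Qed.

Lemma quad_bounds_solve (b : 'cV[R]_d) : exists x, A *m x = b.
Proof.
exists (invmx A *m b); rewrite mulmxA mulmxV ?mul1mx// -row_free_unit.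
apply/inj_row_free => v vA0; apply/eqP; rewrite -trmx_eq0; apply/negP => /negP v0.
have := quad_bounds_pos v0; rewrite -{1}bA.1 -trmx_mul vA0 trmx0 dot0r ltxx //.
Qed.

End Bounds.

(** * Sampling *)

Lemma big_tuple_cons (V : nmodType) (I : finType) (T : nat) (G : T.+1.-tuple I -> V) :
  \sum_(s : T.+1.-tuple I) G s = \sum_i \sum_(t : T.-tuple I) G [tuple of i :: t].
Proof.
rewrite pair_big /= (reindex (fun x : I * T.-tuple I => [tuple of x.1 :: x.2])) //=.
exists (fun s => (thead s, [tuple of behead s])) => [[i t] _ | s _] /=.
  by congr pair; apply: val_inj.
by apply: val_inj; rewrite /= [in RHS](tuple_eta s).
Qed.

Section Sampling.
Context {R : realType} {d n : nat}.
Variables (y : 'I_n -> 'cV[R]_d).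

Let vecsum (s : seq 'I_n) := \sum_(i <- s) y i.

Section Independent.
Variable p : 'I_n -> R.
Hypothesis p1 : \sum_i p i = 1.

Lemma independent_mass T : \sum_(s : T.-tuple 'I_n) \prod_(i <- s) p i = 1.
Proof.
elim: T => [|T IH].
  rewrite (eq_bigr (fun=> 1)) => [|s _]; last by rewrite tuple0 big_nil.
  by rewrite sumr_const card_tuple expn0.
rewrite big_tuple_cons -[RHS]p1; apply: eq_bigr => i _.
under eq_bigr do rewrite big_cons.
by rewrite -mulr_sumr IH mulr1.
Qed.

Hypothesis py0 : \sum_i p i *: y i = 0.

(** Induction on [T], peeling off one draw: its cross term with the other draws vanishes because the
    [p]-mean of [y] is 0. *)
Lemma independent_variance T :
  \sum_(s : T.-tuple 'I_n) (\prod_(i <- s) p i) * dot (vecsum s) (vecsum s) =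
  T%:R * \sum_i p i * dot (y i) (y i).
Proof.
elim: T => [|T IH].
  rewrite mul0r big1// => s _; by rewrite /vecsum tuple0 !big_nil dot0r mulr0.
rewrite big_tuple_cons.
transitivity (\sum_i \sum_(t : T.-tuple 'I_n)
  ((\prod_(j <- t) p j) * (p i * dot (y i) (y i)) +
   (\prod_(j <- t) p j) * (2 * dot (p i *: y i) (vecsum t)) +
   p i * ((\prod_(j <- t) p j) * dot (vecsum t) (vecsum t)))).
  apply: eq_bigr => i _; apply: eq_bigr => t _.
  rewrite big_cons /vecsum big_cons -/(vecsum t) dotDl !dotDr [dot (vecsum t) (y i)]dotC dotZl.
  by ring.
under eq_bigr do rewrite !big_split /= -mulr_suml independent_mass mul1r -mulr_sumr IH.
rewrite !big_split /= -mulr_suml p1 exchange_big /= [X in _ + X + _]big1 => [|t _].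
  by rewrite addr0 -natr1 mulrDl !mul1r addrC.
by rewrite -mulr_sumr -mulr_sumr -dot_suml py0 dot0l !mulr0.
Qed.

End Independent.

Section WithoutReplacement.
Hypothesis y0 : \sum_i y i = 0.

(** Moments over injective tuples are kept unnormalized, so that the recursions in [T] also hold
    when [T > n] and no such tuple exists. *)
Let N T : R := \sum_(s : T.-tuple 'I_n | uniq s) 1.
Let W T : R := \sum_(s : T.-tuple 'I_n | uniq s) \sum_(i <- s) dot (y i) (y i).
Let U T : R := \sum_(s : T.-tuple 'I_n | uniq s) dot (vecsum s) (vecsum s).

Lemma big_uniq_tuple_cons T (G : T.+1.-tuple 'I_n -> R) :
  \sum_(s : T.+1.-tuple 'I_n | uniq s) G s =
  \sum_(t : T.-tuple 'I_n | uniq t) \sum_(i | i \notin t) G [tuple of i :: t].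
Proof.
rewrite big_mkcond big_tuple_cons exchange_big [RHS]big_mkcond; apply: eq_bigr => t _ /=.
case: ifP => ut; last by rewrite big1// => i _; rewrite andbF.
by rewrite [RHS]big_mkcond; apply: eq_bigr => i _; rewrite andbT.
Qed.

Lemma sum_notin (V : zmodType) (G : 'I_n -> V) (t : seq 'I_n) : uniq t ->
  \sum_(i | i \notin t) G i = \sum_i G i - \sum_(i <- t) G i.
Proof.
by move=> ut; rewrite [in RHS](bigID (mem t)) /= big_uniq//= addrAC subrr add0r.
Qed.

Lemma sum_notin_const T (t : T.-tuple 'I_n) (c : R) : uniq t ->
  \sum_(i | i \notin t) c = (n%:R - T%:R) * c.
Proof.
move=> ut; rewrite sum_notin// [X in _ - X]big_const_seq count_predT size_tuple iter_addr_0.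
by rewrite sumr_const card_ord mulrBl !mulr_natl.
Qed.

Lemma mass_step T : N T.+1 = (n%:R - T%:R) * N T.
Proof.
rewrite /N big_uniq_tuple_cons mulr_sumr; apply: eq_bigr => t ut.
by rewrite sum_notin_const.
Qed.

Lemma mass_falling T : N T = (n ^_ T)%:R.
Proof.
elim: T => [|T IH].
  rewrite /N ffactn0 (eq_bigl predT) => [|s]; last by rewrite tuple0.
  by rewrite sumr_const card_tuple expn0.
rewrite mass_step IH ffactnSr; have [Tn|nT] := leqP T n.
  by rewrite natrM natrB// mulrC.
by rewrite ffact_small// mulr0 mul0n.
Qed.

(** Each injective tuple has [n - T] one-index extensions. They all keep its diagonal sum, and the
    added indices contribute the full sum minus that of the tuple. *)
Lemma diagonal_step T :
  W T.+1 = N T * (\sum_i dot (y i) (y i)) + (n%:R - T%:R - 1) * W T.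
Proof.
rewrite /W big_uniq_tuple_cons /N mulr_suml [X in _ + X]mulr_sumr.
rewrite -big_split /=; apply: eq_bigr => t ut.
under eq_bigr do rewrite big_cons.
rewrite big_split /= sum_notin_const// sum_notin//; ring.
Qed.

(** By symmetry each index belongs to a fraction [T / n] of the injective tuples. *)
Lemma diagonalE T : n%:R * W T = N T * T%:R * \sum_i dot (y i) (y i).
Proof.
elim: T => [|T IH].
  rewrite mulr0 mul0r /W big1 ?mulr0// => s _; by rewrite tuple0 big_nil.
rewrite diagonal_step mass_step mulrDr mulrCA [n%:R * (_ * W T)]mulrCA IH -natr1.
by ring.
Qed.

(* The indices outside an injective tuple sum to minus the tuple's own sum, so
   each newly drawn vector is negatively correlated with the previous ones. *)
Lemma sum_le_diagonal T : U T <= W T.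
Proof.
elim: T => [|T IH].
  rewrite /U /W ler_sum// => s _; by rewrite /vecsum tuple0 !big_nil dot0r.
rewrite diagonal_step.
(* The middle term is what remains of [U T.+1] once the cross term [- 2 U T] is dropped. The
   induction hypothesis is used with the factor [n - T], negative only when there is no injective
   tuple. *)
apply: (@le_trans _ _ (N T * (\sum_i dot (y i) (y i)) - W T + (n%:R - T%:R) * U T)); last first.
  have [nT|nT] := leqP T n.
    have : 0 <= (n%:R - T%:R) * (W T - U T) :> R.
      by rewrite mulr_ge0 ?subr_ge0 ?ler_nat.
    lra.
  have no_uniq (t : T.-tuple 'I_n) : uniq t = false.
    apply/negP => /card_uniqP ct.
    by have := max_card (mem t); rewrite ct size_tuple card_ord leqNgt nT.
  have -> : U T = 0 by rewrite /U big1// => t; rewrite no_uniq.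
  have -> : W T = 0 by rewrite /W big1// => t; rewrite no_uniq.
  by rewrite !mulr0 subr0.
rewrite /U big_uniq_tuple_cons /N /W mulr_suml [X in _ + X]mulr_sumr -sumrB -big_split /=.
apply: ler_sum => t ut.
have -> : \sum_(i | i \notin t) dot (vecsum (i :: t)) (vecsum (i :: t)) =
    \sum_(i | i \notin t) (dot (y i) (y i) + dot (vecsum t) (vecsum t)) +
    2 * dot (\sum_(i | i \notin t) y i) (vecsum t).
  rewrite dot_suml mulr_sumr -big_split /=; apply: eq_bigr => i _.
  rewrite /vecsum big_cons -/(vecsum t) dotDl !dotDr [dot (vecsum t) (y i)]dotC; ring.
rewrite big_split /= sum_notin_const// !sum_notin// y0 sub0r dotNl.
have := dot_ge0 (vecsum t); rewrite /vecsum; lra.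
Qed.

Lemma without_replacement_variance T :
  \sum_(s : T.-tuple 'I_n) (if uniq s then (n ^_ T)%:R^-1 else 0) *
    dot (vecsum s) (vecsum s) <=
  T%:R * \sum_i n%:R^-1 * dot (y i) (y i).
Proof.
have -> : \sum_(s : T.-tuple 'I_n) (if uniq s then (n ^_ T)%:R^-1 else 0) *
   dot (vecsum s) (vecsum s) = (N T)^-1 * U T.
  rewrite mass_falling /U mulr_sumr big_mkcond [RHS]big_mkcond; apply: eq_bigr => s _ /=.
  by case: ifP => // _; rewrite mul0r.
have rhs0 : 0 <= T%:R * \sum_i n%:R^-1 * dot (y i) (y i).
  by rewrite mulr_ge0// sumr_ge0// => i _; rewrite mulr_ge0 ?dot_ge0.
(* Without injective tuples [N T] is 0 and so is its inverse, which makes the left side 0. *)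
have [->|N0] := eqVneq (N T) 0; first by rewrite invr0 mul0r.
have Ngt0 : 0 < N T by rewrite lt_def N0 /N sumr_ge0.
rewrite ler_pdivrMl// (le_trans (sum_le_diagonal T))//.
have [n0|n0] := eqVneq (n%:R : R) 0.
  have no_I (i : 'I_n) : False.
    by move/eqP: n0; rewrite pnatr_eq0 => /eqP n0; case: i => i; rewrite n0.
  rewrite /W big1 ?(mulr_ge0 (ltW Ngt0))// => s _; rewrite big1_seq// => i; by case: (no_I i).
have -> : W T = n%:R^-1 * (n%:R * W T) by rewrite mulKf.
by rewrite diagonalE -mulr_sumr le_eqVlt; apply/orP; left; apply/eqP; ring.
Qed.

(** An inequality, because the total weight is 0 instead of 1 when [T > n]. *)
Lemma without_replacement_mass T :
  \sum_(s : T.-tuple 'I_n) (if uniq s then (n ^_ T)%:R^-1 else 0 : R) <= 1.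
Proof.
rewrite -big_mkcond /=; under eq_bigr do rewrite -[_^-1]mulr1.
rewrite -mulr_sumr -/(N T) mass_falling.
by have [->|h] := eqVneq ((n ^_ T)%:R : R) 0; rewrite ?mulr0// mulVf.
Qed.

End WithoutReplacement.
End Sampling.

(** * Mean-square error of the subsampled Hessian under each scheme *)

Section SchemeVariance.
Context {R : realType} {d n T : nat}.
Variables (H : 'I_n -> 'M[R]_d) (p : 'I_n -> R) (q : T.-tuple 'I_n -> R).
Hypothesis n0 : (0 < n)%N.
Hypothesis scheme : sampling_scheme H p q.

Let Hbar := n%:R^-1 *: \sum_(i < n) H i.

Lemma uniform_mass : \sum_(i < n) n%:R^-1 = 1 :> R.
Proof. by rewrite sumr_const card_ord -[n%:R^-1 *+ n]mulr_natr mulVf ?pnatr_eq0 -?lt0n. Qed.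

Lemma scheme_index : [/\ forall i, 0 <= p i, \sum_i p i = 1 & \sum_i p i *: H i = Hbar].
Proof.
have uni : (forall i, p i = n%:R^-1) ->
    [/\ forall i, 0 <= p i, \sum_i p i = 1 & \sum_i p i *: H i = Hbar].
  move=> pE; split.
  - by move=> i; rewrite pE invr_ge0.
  - by under eq_bigr do rewrite pE; rewrite uniform_mass.
  - by under eq_bigr do rewrite pE; rewrite -scaler_sumr.
by case: scheme => [pE _|pE _|p0 p1 _ pH]; [exact: uni|exact: uni|split].
Qed.

Lemma scheme_ge0 s : 0 <= q s.
Proof.
have [p0 _ _] := scheme_index.
case: scheme => [_ ->|_ ->|_ _ -> _]; rewrite ?prodr_ge0//.
by case: ifP.
Qed.

Lemma scheme_mass : \sum_s q s <= 1.
Proof.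
have [_ p1 _] := scheme_index.
case: scheme => [_ qE|_ qE|_ _ qE _]; under eq_bigr do rewrite qE.
- by rewrite independent_mass.
- exact: without_replacement_mass.
- by rewrite independent_mass.
Qed.

Lemma scheme_variance (y : 'I_n -> 'cV[R]_d) : \sum_i p i *: y i = 0 ->
  \sum_s q s * dot (\sum_(i <- s) y i) (\sum_(i <- s) y i) <=
  T%:R * \sum_i p i * dot (y i) (y i).
Proof.
have [_ p1 _] := scheme_index => py.
case: scheme => [_ qE|pE qE|_ _ qE _]; under eq_bigr do rewrite qE.
- by rewrite independent_variance.
- under [in leRHS]eq_bigr do rewrite pE.
  apply: without_replacement_variance; apply: (@scalerI _ _ (n%:R^-1 : R)).
    by rewrite invr_eq0 pnatr_eq0 -lt0n.
  by rewrite scaler0 scaler_sumr -[RHS]py; apply: eq_bigr => i _; rewrite pE.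
- by rewrite independent_variance.
Qed.

(** The vectors [y i = (H i - Hbar) e] have mean 0 and the error is their average over the sample,
    so [scheme_variance] yields the factor [1 / T]. By symmetry of [H i - Hbar], their mean square
    is the quadratic form at [e] of the matrix bounded by [sigma2]. *)
Lemma subsampling_error (sigma2 : R) (e : 'cV[R]_d) :
  (0 < T)%N -> (forall i, (H i)^T = H i) ->
  spectral_norm (\sum_i p i *: ((H i - Hbar) *m (H i - Hbar))) <= sigma2 ->
  \sum_s q s * enorm ((T%:R^-1 *: (\sum_(i <- s) H i) - Hbar) *m e) ^+ 2 <=
  sigma2 / T%:R * enorm e ^+ 2.
Proof.
move=> T0 sH hs; have [p0 p1 pH] := scheme_index.
have T0' : 0 < T%:R :> R by rewrite ltr0n.
pose y i := (H i - Hbar) *m e.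
have py : \sum_i p i *: y i = 0.
  rewrite /y; under eq_bigr do rewrite scalemxAl.
  rewrite -mulmx_suml; under eq_bigr do rewrite scalerBr.
  by rewrite sumrB -scaler_suml p1 scale1r pH subrr mul0mx.
have sHbar : Hbar^T = Hbar.
  by rewrite /Hbar linearZ linear_sum /=; congr (_ *: _); apply: eq_bigr => i _.
have errE (s : T.-tuple 'I_n) :
   (T%:R^-1 *: (\sum_(i <- s) H i) - Hbar) *m e = T%:R^-1 *: \sum_(i <- s) y i.
  rewrite /y -mulmx_suml scalemxAl sumrB big_const_seq count_predT size_tuple iter_addr_0.
  by rewrite scalerBr -[Hbar *+ T]scaler_nat scalerA mulVf ?scale1r// gt_eqF.
have yE : \sum_i p i * dot (y i) (y i) <= sigma2 * enorm e ^+ 2.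
  have -> : \sum_i p i * dot (y i) (y i) =
     dot e ((\sum_i p i *: ((H i - Hbar) *m (H i - Hbar))) *m e).
    rewrite mulmx_suml dot_sumr; apply: eq_bigr => i _.
    rewrite -scalemxAl dotZr -mulmxA (dot_sym e)//.
    by rewrite linearB /= sH sHbar.
  apply: le_trans (cauchy_schwarz _ _) _.
  rewrite expr2 mulrA mulrC ler_wpM2r ?enorm_ge0//.
  by apply: le_trans (enorm_mulmx _ _) _; rewrite ler_wpM2r ?enorm_ge0.
under eq_bigr do rewrite errE enormZ exprMn mulrCA sqr_enorm real_normK ?num_real//.
rewrite -mulr_sumr; have := scheme_variance py => hv.
apply: (@le_trans _ _ (T%:R^-1 ^+ 2 * (T%:R * (sigma2 * enorm e ^+ 2)))).
  rewrite ler_wpM2l ?sqr_ge0//; apply: le_trans hv _.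
  by rewrite ler_wpM2l.
by rewrite le_eqVlt; apply/orP; left; apply/eqP; field; rewrite gt_eqF.
Qed.

(* AM-GM: [x <= x^2 / (2 c) + c / 2]. *)
Lemma mean_le_of_square (x : T.-tuple 'I_n -> R) c : 0 <= c ->
  (forall s, 0 <= x s) -> \sum_s q s * x s ^+ 2 <= c ^+ 2 ->
  \sum_s q s * x s <= c.
Proof.
move=> c0 x0 h; have q0 := scheme_ge0; have q1 := scheme_mass.
(* AM-GM divides by [c]; when [c = 0] every weighted square vanishes instead. *)
have [c00|cn0] := eqVneq c 0.
  rewrite big1// => s _; apply/eqP; rewrite -sqrf_eq0 exprMn expr2 -mulrA mulf_eq0.
  have nn (t : T.-tuple 'I_n) : true -> 0 <= q t * x t ^+ 2 by move=> _; rewrite mulr_ge0 ?sqr_ge0.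
  have s0 : \sum_s q s * x s ^+ 2 = 0.
    by apply/eqP; rewrite eq_le sumr_ge0// andbT (le_trans h)// c00 expr0n.
  by rewrite (psumr_eq0P nn s0) ?eqxx ?orbT.
have cp : 0 < c by rewrite lt_def cn0.
apply: (@le_trans _ _ (\sum_s ((2 * c)^-1 * (q s * x s ^+ 2) + c / 2 * q s))).
  apply: ler_sum => s _.
  have -> : (2 * c)^-1 * (q s * x s ^+ 2) + c / 2 * q s =
     q s * ((2 * c)^-1 * (x s ^+ 2 + c ^+ 2)) by field.
  rewrite ler_wpM2l// ler_pdivlMl ?mulr_gt0//.
  by have := sqr_ge0 (x s - c); rewrite sqrrB; lra.
rewrite big_split /= -!mulr_sumr.
apply: (@le_trans _ _ ((2 * c)^-1 * c ^+ 2 + c / 2 * 1)).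
  by rewrite lerD// ler_wpM2l ?invr_ge0 ?mulr_ge0 ?divr_ge0.
by rewrite le_eqVlt; apply/orP; left; apply/eqP; field.
Qed.

End SchemeVariance.

(** * One inexact Newton step *)

Lemma cg_error (R : realType) (d : nat) (A : 'M[R]_d) (b xs : 'cV[R]_d) (mu L tol : R) r :
  0 < mu -> 0 <= tol -> quad_bounds mu L A -> least_cg_steps A tol r -> A *m xs = b ->
  mu * enorm (xs - cg A b r) ^+ 2 <= tol ^+ 2 * (L * enorm xs ^+ 2).
Proof.
case: d A b xs => [|d] A b xs mu0 tol0 bA [lambda [hl r1 ht _]] Axs.
  by move: r1; rewrite leqn0 => /andP[+ /eqP r0]; rewrite r0.
(* The rate holds in the energy norm; passing to the Euclidean norm on both sides costs the factor
   [L / mu] between the squares. *)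
have := cg_rate bA.1 (quad_bounds_pos mu0 bA) hl r1 Axs ht => /= h.
rewrite !sqr_enorm.
have /andP[h1 _] := bA.2 (xs - cg A b r); have /andP[_ h2] := bA.2 xs.
by rewrite (le_trans h1)// (le_trans h)// ler_wpM2l ?sqr_ge0.
Qed.

(** The error is split at the exact Newton direction [xs]. The CG part is at most
    [tol * sqrt kappa * |xs|], and [|xs| <= kappa |e|]; the tolerance cancels the resulting
    [kappa^(3/2)] and leaves [1/8]. *)
Lemma newton_cg_step (R : realType) (d : nat) (A H : 'M[R]_d) (g e : 'cV[R]_d)
    (mu L delta : R) r :
  0 < mu -> 0 < L -> quad_bounds mu L A ->
  least_cg_steps A (1 / (8 * (L / mu) `^ (3 / 2))) r ->
  enorm g <= L * enorm e -> enorm (H *m e - g) <= delta ->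
  enorm (e + cg A (- g) r) <=
    mu^-1 * (enorm ((A - H) *m e) + delta) + enorm e / 8.
Proof.
move=> mu0 L0 bA hr hg hd; set kappa := L / mu in hr *.
have k0 : 0 < kappa by rewrite divr_gt0.
have [xs Axs] := quad_bounds_solve mu0 bA (- g).
have -> : e + cg A (- g) r = (e + xs) + (cg A (- g) r - xs).
  by rewrite addrACA subrr addr0.
apply: le_trans (enorm_triangle _ _) _; apply: lerD.
  rewrite ler_pdivlMl//; apply: le_trans (enorm_mulmx_ge bA _) _.
  have -> : A *m (e + xs) = (A - H) *m e + (H *m e - g).
    by rewrite mulmxDr Axs mulmxBl addrA addrNK.
  by apply: le_trans (enorm_triangle _ _) _; rewrite lerD2l.
rewrite -enormN opprB.
have xsle : mu * enorm xs <= L * enorm e.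
  by rewrite (le_trans (enorm_mulmx_ge bA xs))// Axs enormN.
have k32 : 0 < kappa `^ (3 / 2) by rewrite powR_gt0.
have ksq : (kappa `^ (3 / 2)) ^+ 2 = kappa ^+ 3.
  rewrite -powR_mulrn ?powR_ge0// -powRrM divfK//.
  by rewrite -powR_mulrn ?ltW.
set tol := 1 / _ in hr.
have tolE : tol ^+ 2 * kappa ^+ 3 = (1 / 8) ^+ 2.
  by rewrite -ksq /tol; field; rewrite gt_eqF.
have tol0 : 0 <= tol by rewrite divr_ge0 ?mulr_ge0 ?ltW.
have := cg_error mu0 tol0 bA hr Axs => h.
rewrite -ler_sqr ?nnegrE ?divr_ge0 ?enorm_ge0//.
rewrite -(ler_pM2l mu0) (le_trans h)//.
have xs2 : enorm xs ^+ 2 <= kappa ^+ 2 * enorm e ^+ 2.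
  have ke : 0 <= kappa * enorm e by apply: mulr_ge0; rewrite ?enorm_ge0// ltW.
  rewrite -exprMn lerXn2r ?nnegrE ?enorm_ge0//.
  by rewrite /kappa mulrAC ler_pdivlMr// mulrC.
apply: (@le_trans _ _ (tol ^+ 2 * (L * (kappa ^+ 2 * enorm e ^+ 2)))).
  by rewrite ler_wpM2l ?sqr_ge0// ler_wpM2l// ltW.
have LE : L = mu * kappa by rewrite /kappa mulrC divfK// gt_eqF.
have -> : tol ^+ 2 * (L * (kappa ^+ 2 * enorm e ^+ 2)) =
   mu * (tol ^+ 2 * kappa ^+ 3) * enorm e ^+ 2 by rewrite {1}LE; ring.
by rewrite tolE le_eqVlt; apply/orP; left; apply/eqP; field.
Qed.

(** * Expectations over finite histories *)

Section FinitePartition.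
Context {R : realType} (disp : measure_display) (Omega : measurableType disp).
Variables (P : probability Omega R) (I : finType) (Y : Omega -> I).
Hypothesis mY : forall i, measurable [set o | Y o = i].

(** The integrand is a finite combination of indicators of the cells of [Y], so expectations become
    finite real sums. *)
Lemma expectation_finite (f : I -> R) : (forall i, 0 <= f i) ->
  ('E_P[fun o => f (Y o)] = (\sum_i f i * fine (P [set o | Y o = i]))%:E)%E.
Proof.
move=> f0; rewrite unlock.
have fE o : (f (Y o))%:E = (\sum_(i <- index_enum I) (f i)%:E * (\1_[set o | Y o = i] o)%:E)%E.
  rewrite (bigD1 (Y o)) //= indicE mem_set// mule1 big1 ?adde0// => i iY.
  by rewrite indicE memNset ?mule0//= => /esym/eqP; rewrite (negPf iY).
under eq_integral do rewrite fE.
rewrite ge0_integral_sum//; last 2 first.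
  by move=> i; apply: measurable_funeM; apply/measurable_EFinP; exact: measurable_indic.
  by move=> i o _; rewrite mule_ge0 ?lee_fin.
rewrite -sumEFin; apply: eq_bigr => i _.
rewrite ge0_integralZl_EFin//; last first.
  by apply/measurable_EFinP; exact: measurable_indic.
by rewrite integral_indic// setIT EFinM fineK// fin_num_measure.
Qed.

End FinitePartition.

(** Lets iterates be written as functions of the sample history; [v0] fills in the values that [Y]
    never takes. *)
Lemma factor_through (Omega I V : Type) (v0 : V) (Y : Omega -> I) (X : Omega -> V) :
  (forall o o', Y o = Y o' -> X o = X o') -> exists f : I -> V, forall o, X o = f (Y o).
Proof.
move=> XY.
exists (fun i => if pselect (exists o, Y o = i) is left h then X (projT1 (cid h)) else v0).
move=> o; case: pselect => [h|]; last by case; exists o.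
by apply: XY; rewrite (projT2 (cid h)).
Qed.


(** * Iterates as functions of the sample history *)

Lemma ordered_spectrum_uniq (R : realType) d (A : 'M[R]_d) l1 l2 :
  ordered_spectrum A l1 -> ordered_spectrum A l2 -> l1 = l2.
Proof.
move=> [s1 e1] [s2 e2]; apply: (sorted_eq le_trans le_anti) => //.
by apply: prod_XsubC_eq; rewrite -e1.
Qed.

(** Makes the number of CG steps a function of the subsampled Hessian, so that the next iterate
    depends only on the current one and the sample. *)
Lemma least_cg_steps_uniq (R : realType) d (A : 'M[R]_d) tol r1 r2 :
  least_cg_steps A tol r1 -> least_cg_steps A tol r2 -> r1 = r2.
Proof.
move=> [l1 [s1 i1 t1 m1]] [l2 [s2 i2 t2 m2]].
move: i2 t2 m2; rewrite -(ordered_spectrum_uniq s1 s2) => i2 t2 m2.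
by apply/eqP; rewrite eqn_leq m1// m2.
Qed.

Section Iterates.
Context {R : realType} {d n T : nat} {Omega : Type}.
Variables (F : 'I_n -> 'cV[R]_d -> R) (alpha : nat -> R) (w0 : 'cV[R]_d).
Variables (S : nat -> Omega -> T.-tuple 'I_n) (r : nat -> Omega -> nat).
Variables (w : nat -> Omega -> 'cV[R]_d) (tol : R).
Hypothesis ssn : SSN_CG F alpha w0 S r w.
Hypothesis hr : forall k o,
  least_cg_steps (subsampled_hessian F (S k o) (w k o)) tol (r k o).

(** A finite function on ['I_k], so that histories range over a finite type. *)
Definition history k (o : Omega) : {ffun 'I_k -> T.-tuple 'I_n} := [ffun j : 'I_k => S j o].

Lemma historyP k o o' :
  history k o = history k o' <-> forall j, (j < k)%N -> S j o = S j o'.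
Proof.
split=> [/ffunP h j jk|h]; first by have := h (Ordinal jk); rewrite !ffunE.
by apply/ffunP => j; rewrite !ffunE h.
Qed.

Lemma iterate_next k o o' : w k o = w k o' -> S k o = S k o' -> w k.+1 o = w k.+1 o'.
Proof.
move=> ww SS; rewrite !(SSN_CG_next ssn) -ww -SS; congr (_ + _ *: cg _ _ _).
by apply: (least_cg_steps_uniq (hr k o)); rewrite ww SS.
Qed.

Lemma iterate_history k o o' : history k o = history k o' -> w k o = w k o'.
Proof.
move=> /historyP; elim: k => [|k IH] h; first by rewrite !(SSN_CG_init ssn).
by apply: iterate_next; [apply: IH => j jk; apply: h; exact: ltnW|exact: h].
Qed.

End Iterates.

(** * Conditioning on the sample history *)

Section Conditioning.
Context {R : realType} {d n T : nat}.
Context (disp : measure_display) (Omega : measurableType disp) (P : probability Omega R).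
Variables (q : nat -> 'cV[R]_d -> T.-tuple 'I_n -> R).
Variables (S : nat -> Omega -> T.-tuple 'I_n) (w : nat -> Omega -> 'cV[R]_d).
Hypothesis sampled : sampled_from P q S w.
Hypothesis w_history : forall k o o', history S k o = history S k o' -> w k o = w k o'.
Hypothesis w_next : forall k o o', w k o = w k o' -> S k o = S k o' -> w k.+1 o = w k.+1 o'.
Hypothesis q_ge0 : forall k v s, 0 <= q k v s.

Lemma measurable_history k h : measurable [set o | history S k o = h].
Proof.
have -> : [set o | history S k o = h] =
    \bigcap_(j in [set: 'I_k]) [set o | S j o = h j].
  apply/seteqP; split => o /= hE; first by move=> j _ /=; rewrite -hE ffunE.
  by apply/ffunP => j; rewrite ffunE; exact: hE.
apply: fin_bigcap_measurable => // j _; exact: sampled.1.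
Qed.

Lemma measurable_history_sample k hs :
  measurable [set o | (history S k o, S k o) = hs].
Proof.
case: hs => h s; have -> : [set o | (history S k o, S k o) = (h, s)] =
    [set o | history S k o = h] `&` [set o | S k o = s].
  by apply/seteqP; split => o /= => [[-> ->]//|[-> ->]].
by apply: measurableI; [exact: measurable_history|exact: sampled.1].
Qed.

(** The history determines the iterate, so the conditioning event of [sampled_from] is exactly the
    event of a given history. *)
Lemma history_sample_prob k o s :
  fine (P [set o' | (history S k o', S k o') = (history S k o, s)]) =
  q k (w k o) s * fine (P [set o' | history S k o' = history S k o]).
Proof.
have := sampled.2 k (S^~ o) (w k o) s => /=.
have -> : [set o0 | (forall j : nat, (j < k)%N -> S j o0 = S j o) /\ w k o0 = w k o] =
    [set o' | history S k o' = history S k o].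
  apply/seteqP; split => o' /=; first by case=> /historyP.
  by move=> ho; split; [exact/historyP|exact: w_history].
have -> : [set o' | (history S k o', S k o') = (history S k o, s)] =
    [set o' | history S k o' = history S k o] `&` [set o | S k o = s].
  by apply/seteqP; split => o' /= => [[-> ->]//|[-> ->]].
by move=> ->; rewrite fineM// fin_num_measure//; exact: measurable_history.
Qed.

(** The tower property: sum over the samples inside each history first, then over the histories. *)
Lemma expectation_step k (phi : 'cV[R]_d -> R) (beta : 'cV[R]_d -> T.-tuple 'I_n -> R)
    (B : 'cV[R]_d -> R) :
  (forall v, 0 <= phi v) -> (forall v s, 0 <= beta v s) ->
  (forall o, phi (w k.+1 o) <= beta (w k o) (S k o)) ->
  (forall v, \sum_s q k v s * beta v s <= B v) ->
  ('E_P[fun o => phi (w k.+1 o)] <= 'E_P[fun o => B (w k o)])%E.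
Proof.
move=> phi0 beta0 phib betaB.
have B0 v : 0 <= B v.
  by apply: le_trans (betaB v); rewrite sumr_ge0// => s _; rewrite mulr_ge0.
have [g gE] := factor_through 0 (Y := fun o => (history S k o, S k o)) (X := w k.+1)
   (fun o o' E => w_next (w_history (f_equal fst E)) (f_equal snd E)).
have [f fE] := factor_through 0 (@w_history k).
under eq_fun do rewrite gE; under [in leRHS]eq_fun do rewrite fE.
have /= -> := expectation_finite P (@measurable_history_sample k)
  (f := phi \o g) (fun=> phi0 _).
have /= -> := expectation_finite P (@measurable_history k) (f := B \o f) (fun=> B0 _).
rewrite lee_fin.
have -> : \sum_hs phi (g hs) * fine (P [set o | (history S k o, S k o) = hs]) =
    \sum_h \sum_s phi (g (h, s)) * fine (P [set o | (history S k o, S k o) = (h, s)]).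
  by rewrite pair_big /=; apply: eq_bigr => -[h s].
apply: ler_sum => h _.
(* [f] and [g] are meaningful only on values that occur; the other cells are empty and have
   probability 0. *)
have [ [ o ho]|no] := pselect (exists o, history S k o = h); last first.
  rewrite big1 => [|s _]; last first.
    rewrite (_ : [set o | _] = set0) ?measure0 ?mulr0//.
    by rewrite -subset0 => o /= [ho _]; apply: no; exists o.
  by rewrite mulr_ge0// fine_ge0.
rewrite -ho -fE; apply: (@le_trans _ _ (\sum_s (q k (w k o) s * beta (w k o) s) *
   fine (P [set o' | history S k o' = history S k o]))); last first.
  by rewrite -mulr_suml ler_wpM2r ?fine_ge0.
apply: ler_sum => s _.
have [ [ o' /= ho']|no] := pselect (exists o', (history S k o', S k o') = (history S k o, s)).
  rewrite history_sample_prob mulrCA mulrA ler_wpM2r ?fine_ge0// ler_wpM2l//.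
  by rewrite -ho' -gE; case: ho' => /w_history <- <-.
rewrite (_ : [set o | _] = set0) ?measure0 ?mulr0 ?mulr_ge0 ?fine_ge0//.
by rewrite -subset0 => o' /= ho'; apply: no; exists o'.
Qed.

(** One finite law serves all test functions, so the moments of the error and the mean of [B] are
    related by linearity of sums. *)
Lemma iterate_law k : exists (pi : {ffun 'I_k -> T.-tuple 'I_n} -> R)
    (v : {ffun 'I_k -> T.-tuple 'I_n} -> 'cV[R]_d),
  (forall h, 0 <= pi h) /\
  forall phi : 'cV[R]_d -> R, (forall v, 0 <= phi v) ->
  ('E_P[fun o => phi (w k o)] = (\sum_h phi (v h) * pi h)%:E)%E.
Proof.
have [f fE] := factor_through 0 (@w_history k).
exists (fun h => fine (P [set o | history S k o = h])), f.
split=> [h|phi phi0]; first exact: fine_ge0.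
under eq_fun do rewrite fE.
exact: (expectation_finite P (@measurable_history k) (f := phi \o f) (fun=> phi0 _)).
Qed.

End Conditioning.

(** * Linear convergence in expectation *)

Theorem theorem5p1 (R : realType) (d n T : nat)
    (F : 'I_n -> 'cV[R]_d -> R)
    (mu L kappa M gamma sigma : R) (wstar w0 : 'cV[R]_d)
    (disp : measure_display) (Omega : measurableType disp)
    (P : probability Omega R)
    (p : nat -> 'cV[R]_d -> 'I_n -> R)
    (q : nat -> 'cV[R]_d -> T.-tuple 'I_n -> R)
    (alpha : nat -> R)
    (smp : nat -> Omega -> T.-tuple 'I_n)
    (r : nat -> Omega -> nat)
    (w : nat -> Omega -> 'cV[R]_d)
    (hd : (0 < d)%N) (hn : (0 < n)%N) (hT : (0 < T)%N)
    (hconvex : forall i, @convex_function R 'cV[R]_d setT (F i))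
    (hwstar : forall v, average F wstar <= average F v)
    (* A.1 *)
    (hmu : 0 < mu) (hL : 0 < L) (hkappa : kappa = L / mu)
    (hC2 : forall i, twice_continuously_differentiable (F i))
    (hA1 : forall i v, loewner_le mu%:M (hessian (F i) v) /\
                       loewner_le (hessian (F i) v) L%:M)
    (* A.2 *)
    (hM : 0 < M)
    (hA2 : forall v z,
       spectral_norm (hessian (average F) v - hessian (average F) z)
         <= M * enorm (v - z))
    (* A.3 *)
    (hA3 : forall k v,
       spectral_norm (\sum_(i < n) p k v i *:
         ((hessian (F i) v - hessian (average F) v) *m
          (hessian (F i) v - hessian (average F) v))) <= sigma ^+ 2)
    (* SSN-CG and its sampling *)
    (hscheme : forall k v,
       sampling_scheme (fun i => hessian (F i) v) (p k v) (q k v))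
    (hsample : sampled_from P q smp w)
    (hSSN : SSN_CG F alpha w0 smp r w)
    (halpha : forall k, alpha k = 1)
    (* A.4 *)
    (hgamma : 0 < gamma)
    (hA4 : forall k,
       ('E_P[(fun o => enorm (w k o - wstar) ^+ 2)%R]
          <= gamma%:E * 'E_P[(fun o => enorm (w k o - wstar))%R] ^+ 2)%E)
    (* parameters *)
    (hTsize : 64 * sigma ^+ 2 / mu ^+ 2 <= T%:R)
    (hr : forall k o,
       least_cg_steps (subsampled_hessian F (smp k o) (w k o))
         (1 / (8 * kappa `^ (3 / 2))) (r k o))
    (hw0 : enorm (w0 - wstar)
             <= Num.min (mu / (2 * M)) (mu / (2 * gamma * M))) :
  forall k,
    ('E_P[(fun o => enorm (w k.+1 o - wstar))%R]
       <= (1 / 2)%R%:E * 'E_P[(fun o => enorm (w k o - wstar))%R])%E.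
Proof.
have bH i v := loewner_quad_bounds (hA1 i v).
have bSub (s : T.-tuple 'I_n) v : quad_bounds mu L (subsampled_hessian F s v).
  rewrite /subsampled_hessian -[X in X%:R](size_tuple s).
  by apply: quad_bounds_mean; rewrite ?size_tuple.
have bAvg v : quad_bounds mu L (hessian (average F) v).
  rewrite hessian_average//.
  have := @quad_bounds_mean R d _ (index_enum 'I_n) (fun i => hessian (F i) v) mu L.
  by rewrite -[index_enum _]enumT size_enum_ord; apply.
have dF : forall v, differentiable (average F) v.
  by move=> v; apply: differentiable_average => i; case: (hC2 i).
have dpF : forall i v, differentiable (partial i (average F)) v.
  by move=> i v; exact: differentiable_partial_average.
have grad0 : gradient (average F) wstar = 0 by exact: gradient_min.
(* The mean value identity is tested with [u] the gradient itself: [u . u = (v - wstar) . H u <= L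
   |v - wstar| |u|], and [|u|] cancels. *)
have gle v : enorm (gradient (average F) v) <= L * enorm (v - wstar).
  have [u uE] : exists u, u = gradient (average F) v by eexists.
  have [t] := gradient_mvt wstar (v - wstar) u dpF.
  rewrite grad0 dot0r subr0 [wstar + _]addrCA subrr addr0 -uE => uu.
  have [->|u0] := eqVneq (enorm u) 0; first by rewrite mulr_ge0 ?enorm_ge0 ?ltW.
  have upos : 0 < enorm u by rewrite lt_def u0 enorm_ge0.
  rewrite -(ler_pM2r upos) -expr2 sqr_enorm uu (le_trans (cauchy_schwarz _ _))//.
  rewrite mulrC -mulrA [enorm (v - _) * _]mulrC mulrA ler_wpM2r ?enorm_ge0//.
  exact: (enorm_mulmx_le hmu (bAvg _)).
have taylor v : enorm (hessian (average F) v *m (v - wstar) - gradient (average F) v) <=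
    M / 2 * enorm (v - wstar) ^+ 2.
  have := gradient_taylor wstar v dpF (fun z => (bAvg z).1) (ltW hM) hA2.
  by rewrite grad0 subr0 -enormN opprB.
(* [beta] bounds the next error for a given sample and [B] bounds its mean over samples; the [1/4]
   in [B] is [1/8] from sampling plus [1/8] from CG. *)
pose beta (v : 'cV[R]_d) (s : T.-tuple 'I_n) :=
  mu^-1 * (enorm ((subsampled_hessian F s v - hessian (average F) v) *m (v - wstar)) +
    M / 2 * enorm (v - wstar) ^+ 2) + enorm (v - wstar) / 8.
pose B (v : 'cV[R]_d) := M / (2 * mu) * enorm (v - wstar) ^+ 2 + enorm (v - wstar) / 4.
have q0 k v s : 0 <= q k v s by exact: scheme_ge0 (hscheme k v) s.
have betaB k v : \sum_s q k v s * beta v s <= B v.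
  have [x xE] : exists x, x = fun s : T.-tuple 'I_n =>
    enorm ((subsampled_hessian F s v - hessian (average F) v) *m (v - wstar)) by eexists.
  have [e eE] : exists e, e = enorm (v - wstar) by eexists.
  have e0 : 0 <= e by rewrite eE enorm_ge0.
  have T0 : 0 < T%:R :> R by rewrite ltr0n.
  (* The sample size gives [sigma^2 / T <= mu^2 / 64], so the mean square is at most
     [(mu e / 8)^2]. *)
  have mean_x : \sum_s q k v s * x s <= mu * e / 8.
    apply: (mean_le_of_square hn (hscheme k v)) => [|s|].
    - by rewrite divr_ge0 ?mulr_ge0 ?(ltW hmu).
    - by rewrite xE enorm_ge0.
    rewrite xE; have := hA3 k v; rewrite hessian_average// => h3.
    apply: le_trans (subsampling_error hn (hscheme k v) (v - wstar) hT
      (fun i => (bH i v).1) h3) _.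
    rewrite -eE (_ : (mu * e / 8) ^+ 2 = mu ^+ 2 / 64 * e ^+ 2); last by field.
    rewrite ler_wpM2r ?sqr_ge0// ler_pdivrMr//.
    move: hTsize; rewrite ler_pdivrMr ?exprn_gt0// => h64.
    by rewrite mulrAC ler_pdivlMr// mulrC [mu ^+ 2 * _]mulrC.
  have mass := scheme_mass hn (hscheme k v).
  (* The part of [beta] that does not depend on the sample is nonnegative, so a total mass of at
     most 1 suffices. *)
  have -> : \sum_s q k v s * beta v s = mu^-1 * (\sum_s q k v s * x s) +
      (mu^-1 * (M / 2 * e ^+ 2) + e / 8) * \sum_s q k v s.
    rewrite !mulr_sumr -big_split /=; apply: eq_bigr => s _.
    by rewrite xE eE /beta; ring.
  have mui : 0 <= mu^-1 by rewrite invr_ge0 ltW.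
  apply: (@le_trans _ _ (mu^-1 * (mu * e / 8) + (mu^-1 * (M / 2 * e ^+ 2) + e / 8) * 1)).
    rewrite lerD// ler_wpM2l// addr_ge0 ?mulr_ge0 ?divr_ge0 ?sqr_ge0//; exact: ltW.
  rewrite /B -eE le_eqVlt; apply/orP; left; apply/eqP; field.
  by rewrite gt_eqF.
have w_history := iterate_history hSSN hr.
have w_next := iterate_next hSSN hr.
have step k : ('E_P[fun o => enorm (w k.+1 o - wstar)] <= 'E_P[fun o => B (w k o)])%E.
  apply: (expectation_step hsample w_history w_next q0 (beta := beta)
     (phi := fun v => enorm (v - wstar))) => //.
  - by move=> v; exact: enorm_ge0.
  - move=> v s; apply: addr_ge0; last by rewrite divr_ge0 ?enorm_ge0.
    apply: mulr_ge0; first by rewrite invr_ge0 ltW.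
    by rewrite addr_ge0 ?enorm_ge0// mulr_ge0 ?sqr_ge0// divr_ge0 ?(ltW hM).
  - move=> o; rewrite (SSN_CG_next hSSN) halpha scale1r addrAC.
    apply: (newton_cg_step hmu hL (bSub _ _) _ (gle _) (taylor _)).
    by rewrite -hkappa; exact: hr.
have law k : exists a b : R, [/\ 0 <= a,
   ('E_P[fun o => enorm (w k o - wstar)] = a%:E)%E,
   ('E_P[(fun o => enorm (w k o - wstar) ^+ 2)%R] = b%:E)%E &
   ('E_P[fun o => B (w k o)] = (M / (2 * mu) * b + a / 4)%:E)%E].
  have [pi [v [pi0 lawE]]] := iterate_law hsample w_history k.
  exists (\sum_h enorm (v h - wstar) * pi h), (\sum_h enorm (v h - wstar) ^+ 2 * pi h).
  have aE := lawE (fun v => enorm (v - wstar)) (fun v => enorm_ge0 _).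
  split.
  - by rewrite sumr_ge0// => h _; rewrite mulr_ge0 ?enorm_ge0.
  - exact: aE.
  - exact: (lawE (fun v => enorm (v - wstar) ^+ 2) (fun v => sqr_ge0 _)).
  - rewrite (lawE B) => [|u]; last first.
      rewrite /B addr_ge0 ?divr_ge0 ?enorm_ge0// mulr_ge0 ?sqr_ge0// divr_ge0 ?(ltW hM)//.
      by rewrite mulr_ge0 ?(ltW hmu).
    congr EFin; rewrite mulr_sumr mulr_suml -big_split /=; apply: eq_bigr => h _.
    by rewrite /B; ring.
have rec k a : 'E_P[fun o => enorm (w k o - wstar)]%E = a%:E -> a <= mu / (2 * gamma * M) ->
   ('E_P[fun o => enorm (w k.+1 o - wstar)] <= (a / 2)%:E)%E.
  move=> aE ale; apply: le_trans (step k) _.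
  have [a' [b [a0 a'E bE ->]]] := law k.
  have aa' : a' = a by apply: EFin_inj; rewrite -a'E -aE.
  rewrite aa' in a0 *.
  have := hA4 k; rewrite bE aE -EFin_expe -EFinM !lee_fin => hb.
  have aM : M * gamma * a <= mu / 2.
    move: ale; rewrite ler_pdivlMr ?mulr_gt0// => ale'.
    rewrite ler_pdivlMr// (le_trans _ ale')// le_eqVlt; apply/orP; left; apply/eqP; ring.
  have Mb : M * b <= mu / 2 * a.
    apply: (@le_trans _ _ (M * (gamma * a ^+ 2))); first by rewrite ler_wpM2l ?(ltW hM).
    rewrite (_ : M * (gamma * a ^+ 2) = M * gamma * a * a); last by ring.
    exact: ler_wpM2r.
  have -> : M / (2 * mu) * b = (M * b) / (2 * mu) by rewrite mulrAC.
  have : M * b / (2 * mu) <= a / 4.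
    rewrite ler_pdivrMr ?mulr_gt0// (le_trans Mb)// le_eqVlt; apply/orP; left.
    by apply/eqP; field.
  by lra.
(* Halving keeps the mean error within [mu / (2 gamma M)], so [rec] applies at every [k]; the bound
   on [w0] is the base case. *)
have small k : exists2 a, 'E_P[fun o => enorm (w k o - wstar)]%E = a%:E &
    0 <= a <= mu / (2 * gamma * M).
  elim: k => [|k [a aE /andP[a0 ale]]].
    exists (enorm (w0 - wstar)).
      under eq_fun do rewrite (SSN_CG_init hSSN).
      exact: expectation_cst.
    by rewrite enorm_ge0/= (le_trans hw0)// ge_min lexx orbT.
  have [a' [b [a'0 a'E _ _]]] := law k.+1; exists a' => //.
  rewrite a'0 /=; have := rec k a aE ale; rewrite a'E lee_fin => /le_trans -> //.
  by rewrite (le_trans _ ale)// ler_pdivrMr// ler_peMr// ler1n.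
move=> k; have [a aE /andP[_ ale]] := small k.
by rewrite aE -EFinM; have := rec k a aE ale; rewrite mulrC div1r.
Qed.
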